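(* Let $0<a<b<\infty$ and assign to the edges of the $\mathbb{Z}^2$ nearest-neighbour lattice independent weights, each uniformly distributed on $\{a,b\}$. Let $(k_n)$ be positive integers with $k_n=o(n^{1/22})$. For every $\beta\in(0,1)$ and any $\beta$-quantile $q_\beta=q_\beta(n)$ of $\tau^\star(n,k_n)$, $$\lim_{n\to\infty}\mathbb{P}\big(\tau^\star(n,k_n)<q_\beta\big)=1-\lim_{n\to\infty}\mathbb{P}\big(\tau^\star(n,k_n)>q_\beta\big)=\beta,$$ and the sequence $f^\star_n:=\mathbbm{1}_{\{\tau^\star(n,k_n)>q_\beta\}}$ is noise sensitive.
   Context: For a path $\Gamma$, $T(\Gamma):=\sum_{e\in\Gamma}\omega_e$. $t_i(n,k)$ denotes the left-right crossing time of the rectangle $[0,n]\times[i,i+k-1]$: the infimum of $T(\Gamma)$ over nearest-neighbour paths in that rectangle connecting its left side $\{0\}\times[i,i+k-1]$ to its right side $\{n\}\times[i,i+k-1]$. Set $\tau^\star(n,k):=\min\{t_{(i-1)k}(n,k):i=1,\dots,\lfloor n/k\rfloor\}$. A $\beta$-quantile of $X$ is any $q$ with $\mathbb{P}(X<q)\le\beta\le\mathbb{P}(X\le q)$. Each $f^\star_n$ depends on finitely many weights, viewed as a function on $\{a,b\}^{E_n}$ with uniform product measure; $\omega^\varepsilon$ is obtained from $\omega$ by independently resampling each weight with probability $\varepsilon$; $(f_n)$ is noise sensitive if for every $\varepsilon>0$, $\mathbb{E}[f_n(\omega)f_n(\omega^\varepsilon)]-\mathbb{E}[f_n(\omega)]^2\to0$.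 *)

(* Defs.v *)
From HB Require Import structures.
From mathcomp Require Import all_boot all_order all_algebra.
From mathcomp Require Import all_classical all_reals all_analysis.

Set Implicit Arguments. Unset Strict Implicit. Unset Printing Implicit Defensive.
Import Order.TTheory GRing.Theory Num.Theory numFieldNormedType.Exports.
Local Open Scope classical_set_scope.
Local Open Scope ring_scope.

(* Edge labelling: an edge of Z^2 is identified by its lower/left endpoint
   (x,y) and a direction d (false = horizontal edge (x,y)-(x+1,y),
   true = vertical edge (x,y)-(x,y+1)).  An environment is a function
   om : nat -> nat -> bool -> R  (only nonnegative coordinates are relevant,
   since all rectangles lie in [0,n] x [0,n]). *)

Definition adj (p q : nat * nat) : bool :=
  [|| q == (p.1.+1, p.2), p == (q.1.+1, q.2),
      q == (p.1, p.2.+1) | p == (q.1, q.2.+1)].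

Definition step_w {R : realType} (om : nat -> nat -> bool -> R)
  (p q : nat * nat) : R :=
  if q == (p.1.+1, p.2) then om p.1 p.2 false
  else if p == (q.1.+1, q.2) then om q.1 q.2 false
  else if q == (p.1, p.2.+1) then om p.1 p.2 true
  else om q.1 q.2 true.

Definition path_time {R : realType} (om : nat -> nat -> bool -> R)
  (v0 : nat * nat) (s : seq (nat * nat)) : R :=
  \sum_(pq <- zip (v0 :: s) s) step_w om pq.1 pq.2.

Definition in_rect (n k i : nat) (p : nat * nat) : bool :=
  [&& (p.1 <= n)%N, (i <= p.2)%N & (p.2 < i + k)%N].

Definition crossing (n k i : nat) (v0 : nat * nat) (s : seq (nat * nat)) : bool :=
  [&& path adj v0 s, all (in_rect n k i) (v0 :: s),
      v0.1 == 0%N & (last v0 s).1 == n].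

Definition t_cross {R : realType} (om : nat -> nat -> bool -> R) (n k i : nat) : R :=
  inf [set x : R | exists v0 s, crossing n k i v0 s /\ x = path_time om v0 s].

Definition tau_star {R : realType} (om : nat -> nat -> bool -> R) (n k : nat) : R :=
  inf [set x : R | exists2 i : nat, (0 < i <= n %/ k)%N &
                     x = t_cross om n k ((i - 1) * k)].

(* Finite configuration space: the weights of all edges with lower/left
   endpoint in [0,n]^2 (this contains all edges tau^*(n,k) depends on).
   true <-> weight b, false <-> weight a. *)
Definition cfg (n : nat) := {ffun 'I_n.+1 * 'I_n.+1 * bool -> bool}.

Definition env {R : realType} (a b : R) (n : nat) (w : cfg n) :
    nat -> nat -> bool -> R :=
  fun x y d =>
    match (insub x : option 'I_n.+1), (insub y : option 'I_n.+1) with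
    | Some i, Some j => if w (i, j, d) then b else a
    | _, _ => a
    end.

Definition tauN {R : realType} (a b : R) (k : nat -> nat) (n : nat) (w : cfg n) : R :=
  tau_star (env a b w) n (k n).

Definition Pr {R : realType} (n : nat) (A : pred (cfg n)) : R :=
  (\sum_(w : cfg n) ((A w)%:R : R)) / (#|{: cfg n}|)%:R.

Definition Exp {R : realType} (n : nat) (f : cfg n -> R) : R :=
  (\sum_(w : cfg n) f w) / (#|{: cfg n}|)%:R.

Definition is_quantile {R : realType} (n : nat) (X : cfg n -> R) (beta q : R) : Prop :=
  Pr (fun w => X w < q) <= beta <= Pr (fun w => X w <= q).

(* joint law of (omega_e, omega^eps_e) for one edge:
   omega_e uniform; with prob. eps it is resampled independently. *)
Definition rho {R : realType} (eps : R) (x y : bool) : R :=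
  (1 - eps) / 2 * ((x == y)%:R) + eps / 4.

(* E[f(omega) f(omega^eps)] *)
Definition noise_corr {R : realType} (n : nat) (eps : R) (f : cfg n -> R) : R :=
  \sum_(w : cfg n) \sum_(w' : cfg n)
     (\prod_(e : 'I_n.+1 * 'I_n.+1 * bool) rho eps (w e) (w' e)) * f w * f w'.

Definition noise_sensitive {R : realType} (f : forall n : nat, cfg n -> R) : Prop :=
  forall eps : R, 0 < eps <= 1 ->
    (fun n : nat => noise_corr eps (f n) - (Exp (f n)) ^+ 2) @ \oo --> (0 : R).

(* Main.v *)
Require Import Defs.
From HB Require Import structures.
From mathcomp Require Import all_boot all_order all_algebra.
From mathcomp Require Import all_classical all_reals all_analysis.
From mathcomp Require Import zify ring lra.
Import Order.TTheory GRing.Theory Num.Theory numFieldNormedType.Exports.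
Local Open Scope classical_set_scope.
Local Open Scope ring_scope.

Set Implicit Arguments. Unset Strict Implicit. Unset Printing Implicit Defensive.

(* Let pi and pi' be the probabilities that one rectangle has crossing time <= q,
   resp. < q.  The rectangles use disjoint rows, so their crossing times are
   i.i.d. and P(tau > q) = (1 - pi)^m, P(tau >= q) = (1 - pi')^m with m = n / k.

   Limits: m pi' stays bounded, so it suffices that m (pi - pi') -> 0.  Turn every
   b in the rectangle into a with probability delta.  The law of the result has a
   density close to 1 with respect to the uniform one when delta is small compared
   with (n k)^(-1/2), whereas a near-geodesic contains at least order n / k edges b,
   by planar self-duality at parameter 1/2, so one of them is turned with
   overwhelming probability when delta n / k is large, and the crossing time
   strictly drops.

   Noise sensitivity: if r is the probability that the crossing times before and
   after noise are both <= q, then E[f f^eps] = (1 - 2 pi + r)^m differs from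
   E[f]^2 = (1 - pi)^(2 m) by at most m (r + pi^2); hypercontractivity makes r of
   smaller order than pi, and pi = O(1 / m). *)

(** * Product expectations *)

Section ProductExpectation.
Variables (R : realType) (E V : finType) (mu : E -> V -> R).
Implicit Types (F G : {ffun E -> V} -> R) (D : {pred E}) (w : {ffun E -> V}).

(** The value type [V] is general so that one calculus serves both configurations ([V = bool]) and
    noisy pairs of them ([V = bool * bool]). *)
Definition EE F : R := \sum_(w : {ffun E -> V}) (\prod_e mu e (w e)) * F w.

Definition depends_on (T : Type) D (F : {ffun E -> V} -> T) :=
  forall w w', {in D, w =1 w'} -> F w = F w'.

Lemma EE_prod (g : E -> V -> R) :
  EE (fun w => \prod_e g e (w e)) = \prod_e \sum_v mu e v * g e v.
Proof.
rewrite bigA_distr_bigA; apply: eq_bigr => w _.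
by rewrite -big_split.
Qed.

Lemma EE_eq F G : F =1 G -> EE F = EE G.
Proof. by move=> FG; apply: eq_bigr => w _; rewrite FG. Qed.

Lemma EED F G : EE (fun w => F w + G w) = EE F + EE G.
Proof. by rewrite /EE -big_split; apply: eq_bigr => w _; rewrite mulrDr. Qed.

Lemma EEZ c F : EE (fun w => c * F w) = c * EE F.
Proof. by rewrite /EE big_distrr; apply: eq_bigr => w _; rewrite mulrCA. Qed.

Lemma EE_sum (I : finType) (F : I -> {ffun E -> V} -> R) :
  EE (fun w => \sum_i F i w) = \sum_i EE (F i).
Proof. by rewrite /EE exchange_big; apply: eq_bigr => w _; rewrite big_distrr. Qed.


Lemma EE_perm (s : E -> E) F : injective s -> (forall e v, mu (s e) v = mu e v) ->
  EE (fun w => F [ffun e => w (s e)]) = EE F.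
Proof.
move=> s_inj mus; pose f w : {ffun E -> V} := [ffun e => w (s e)].
have f_inj : injective f.
  move=> w w' /ffunP ww'; apply/ffunP => e.
  by have := ww' (invF s_inj e); rewrite !ffunE f_invF.
rewrite [RHS]/EE (reindex_inj f_inj); apply: eq_bigr => w _; congr (_ * _).
by rewrite (reindex_inj s_inj); apply: eq_bigr => e _; rewrite ffunE mus.
Qed.

Hypothesis mu1 : forall e, \sum_v mu e v = 1.

Lemma EE_cst c : EE (fun=> c) = c.
Proof.
transitivity (c * EE (fun w => \prod_(e : E) 1)).
  by rewrite -EEZ; apply: EE_eq => w; rewrite big1_eq mulr1.
rewrite (EE_prod (fun _ _ => 1)) big1 ?mulr1// => e _.
by under eq_bigr do rewrite mulr1; exact: mu1.
Qed.

Definition mix D w w' : {ffun E -> V} := [ffun e => if e \in D then w e else w' e].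

(* Swapping the coordinates in [D] of two independent copies preserves their
   joint law. *)
Lemma EE_indep D D' F G : [predI D & D'] =1 pred0 ->
  depends_on D F -> depends_on D' G ->
  EE (fun w => F w * G w) = EE F * EE G.
Proof.
move=> DD' FD GD'.
transitivity (EE (fun w => EE (fun w' => F w * G w))).
  by apply: EE_eq => w; rewrite EE_cst.
rewrite /EE big_distrl/=.
under eq_bigr do rewrite big_distrr/=.
under [RHS]eq_bigr do rewrite big_distrr/=.
rewrite [LHS]pair_bigA [RHS]pair_bigA/=.
pose h (p : {ffun E -> V} * {ffun E -> V}) := (mix D p.1 p.2, mix D p.2 p.1).
have hK : involutive h.
  move=> [w w']; congr pair; apply/ffunP => e; rewrite !ffunE/=;
  by case: (e \in D).
rewrite [RHS](reindex_inj (inv_inj hK))/=.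
apply: eq_bigr => -[w w'] _ /=.
rewrite (FD w (mix D w w')); last by move=> e eD; rewrite ffunE eD.
rewrite (GD' w (mix D w' w)); last first.
  by move=> e eD'; rewrite ffunE; have /= := DD' e; rewrite eD' andbT => ->.
set f := F _; set g := G _.
rewrite [RHS]mulrACA mulrA -!big_split/=; congr (_ * _).
by apply: eq_bigr => e _; rewrite !ffunE; case: ifP => // _; rewrite mulrC.
Qed.

Lemma EE_indep_prod (I : finType) (D : I -> {pred E}) (F : I -> {ffun E -> V} -> R) :
  (forall i j e, e \in D i -> e \in D j -> i = j) ->
  (forall i, depends_on (D i) (F i)) ->
  EE (fun w => \prod_i F i w) = \prod_i EE (F i).
Proof.
move=> DD FD.
have : uniq (index_enum I) by exact: index_enum_uniq.
elim: (index_enum I) => [_|i s IHs /= /andP[iNs us]].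
  by rewrite big_nil -[RHS](EE_cst 1); apply: EE_eq => w; rewrite big_nil.
rewrite big_cons -IHs//.
rewrite -(@EE_indep (D i) [pred e | has (fun j => e \in D j) s])//.
- by apply: EE_eq => w; rewrite big_cons.
- move=> e /=; rewrite inE; apply/negP => /andP[ei] /hasP[j js ej].
  by move: iNs; rewrite (DD _ _ _ ei ej) js.
- move=> w w' ww'; rewrite big_seq [RHS]big_seq; apply: eq_bigr => j js.
  by apply: FD => e ej; apply: ww'; rewrite inE; apply/hasP; exists j.
Qed.

Definition upd w e v : {ffun E -> V} := [ffun e' => if e' == e then v else w e'].

(** Conditioning on the coordinate [e]: split by its value and use that [w e] is independent of
    [upd w e v]. This lets the hypercontractive estimate be proved one coordinate at a time. *)
Lemma EE_cond e F : EE F = \sum_v mu e v * EE (fun w => F (upd w e v)).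
Proof.
transitivity (\sum_v EE (fun w => (w e == v)%:R * F (upd w e v))).
  rewrite -EE_sum; apply: EE_eq => w.
  rewrite (bigD1 (w e))//= eqxx mul1r big1 ?addr0; last first.
    by move=> v /negbTE vw; rewrite eq_sym vw mul0r.
  by congr F; apply/ffunP => e'; rewrite ffunE; case: eqP => [->|].
apply: eq_bigr => v _.
rewrite (@EE_indep (pred1 e) (predC1 e)).
- congr (_ * _).
  (* Written as a product over all coordinates, the indicator of [w e == v] has its mean evaluated
     by [EE_prod]. *)
  pose g e' v' : R := if e' == e then (v' == v)%:R else 1.
  transitivity (EE (fun w => \prod_e' g e' (w e'))).
    apply: EE_eq => w; rewrite (bigD1 e)//= {1}/g eqxx big1 ?mulr1// => e' /negbTE.
    by rewrite /g => ->.
  rewrite EE_prod (bigD1 e)//= [X in _ * X]big1 ?mulr1; last first.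
    move=> e' /negbTE ne; rewrite -[RHS](mu1 e'); apply: eq_bigr => v' _.
    by rewrite /g ne mulr1.
  rewrite (bigD1 v)//= /g !eqxx mulr1 big1 ?addr0// => v' /negbTE vv'.
  by rewrite vv' mulr0.
- by move=> e' /=; rewrite !inE; case: eqP.
- by move=> w w' ww'; rewrite (ww' e)// inE.
- move=> w w' ww'; congr F; apply/ffunP => e'; rewrite !ffunE.
  by case: eqP => // /eqP ne; apply: ww'.
Qed.

Hypothesis mu0 : forall e v, 0 <= mu e v.

Lemma EE_le F G : (forall w, F w <= G w) -> EE F <= EE G.
Proof.
by move=> FG; apply: ler_sum => w _; rewrite ler_wpM2l// prodr_ge0.
Qed.

Lemma EE_ge0 F : (forall w, 0 <= F w) -> 0 <= EE F.
Proof. by move=> F0; apply: sumr_ge0 => w _; rewrite mulr_ge0// prodr_ge0. Qed.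

End ProductExpectation.

Definition map_cfg (E V V' : finType) (f : V -> V') (w : {ffun E -> V}) :
  {ffun E -> V'} := [ffun e => f (w e)].

(** Configurations are grouped by image. The weight of a fibre factorizes: expanding the product of
    the one-coordinate fibre sums yields exactly the members of that fibre. *)
Lemma EE_marginal (R : realType) (E V V' : finType) (mu : E -> V -> R)
    (nu : E -> V' -> R) (f : V -> V') (F : {ffun E -> V'} -> R) :
  (forall e v', \sum_(v | f v == v') mu e v = nu e v') ->
  EE mu (fun w => F (map_cfg f w)) = EE nu F.
Proof.
move=> munu; rewrite /EE.
rewrite (partition_big (map_cfg f) xpredT)//=; apply: eq_bigr => w' _.
have -> : \prod_e nu e (w' e) =
    \prod_e \sum_v (if f v == w' e then mu e v else 0).
  by apply: eq_bigr => e _; rewrite -munu big_mkcond.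
rewrite bigA_distr_bigA big_distrl/= big_mkcond/=; apply: eq_bigr => w _.
case: eqP => [<-|ne].
  by congr (_ * _); apply: eq_bigr => e _; rewrite ffunE eqxx.
case: (pickP (fun e => f (w e) != w' e)) => [e fe|all_eq].
  by rewrite (bigD1 e)//= (negbTE fe) !mul0r.
by case: ne; apply/ffunP => e; rewrite ffunE; apply/eqP; move/negbFE: (all_eq e).
Qed.

(** * Planar duality *)

(** The tests follow the order of those in [step_w], so that a step costs the weight of this
    edge. *)
Definition edge_of (p q : nat * nat) : nat * nat * bool :=
  if q == (p.1.+1, p.2) then (p.1, p.2, false)
  else if p == (q.1.+1, q.2) then (q.1, q.2, false)
  else if q == (p.1, p.2.+1) then (p.1, p.2, true)
  else (q.1, q.2, true).

(* No path of [a]-edges crosses the strip between the columns [x0] and [x0 + k]: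
   [h] is 0 on the points that such a path could reach from the left. *)
Definition is_blocked (ob : nat * nat * bool -> bool) (k x0 : nat) : Prop :=
  exists h : nat * nat -> bool,
    [/\ forall p, (p.1 <= x0)%N -> h p = false,
        forall p, (x0 + k <= p.1)%N -> h p = true &
        forall p q, adj p q -> (p.2 < k)%N -> (q.2 < k)%N ->
          h p != h q -> ob (edge_of p q)].

(** The two extreme columns are wired: the function [h] of [is_blocked] is constant on each of them,
    so a [b]-edge inside such a column cannot separate anything. *)
Definition open_step (ob : nat * nat * bool -> bool) (k x0 : nat)
    (p q : nat * nat) : bool :=
  [&& adj p q, (x0 <= p.1 <= x0 + k)%N && (p.2 < k)%N,
      (x0 <= q.1 <= x0 + k)%N && (q.2 < k)%N &
      ob (edge_of p q) ==> (p.1 == q.1) && ((p.1 == x0) || (p.1 == x0 + k)%N)].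

Lemma adjP p q : adj p q ->
  [\/ q = (p.1.+1, p.2) /\ edge_of p q = (p.1, p.2, false),
      p = (q.1.+1, q.2) /\ edge_of p q = (q.1, q.2, false),
      q = (p.1, p.2.+1) /\ edge_of p q = (p.1, p.2, true) |
      p = (q.1, q.2.+1) /\ edge_of p q = (q.1, q.2, true)].
Proof.
case: p q => [x y] [x' y']; rewrite /adj /edge_of /= !xpair_eqE.
case/or4P => /andP[/eqP -> /eqP ->].
- by constructor 1; rewrite !eqxx.
- constructor 2; rewrite !eqxx /=; case: ifP => //; lia.
- constructor 3; rewrite !eqxx /=; do ?[case: ifP => //]; lia.
- constructor 4; do ?[case: ifP => //]; lia.
Qed.

(** Exploration from the left column: either the reachable set meets the right column, or its
    boundary blocks the strip. *)
Lemma blocked_or_open_path ob k x0 : (0 < k)%N -> ~ is_blocked ob k x0 ->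
  exists v0 s, [/\ v0.1 = x0, path (open_step ob k x0) v0 s,
                   ((last v0 s).2 < k)%N & (last v0 s).1 = (x0 + k)%N].
Proof.
move=> k_gt0 nb.
pose reach p := exists v0 s, [/\ v0.1 = x0, path (open_step ob k x0) v0 s & last v0 s = p].
have [[p [[v0 [s [v0x ps lp]]] pk p1]]|noreach] :=
  pselect (exists p, [/\ reach p, (p.2 < k)%N & p.1 = (x0 + k)%N]).
  by exists v0, s; rewrite lp.
exfalso; apply: nb.
(* Strictly between the extreme columns this is the complement of the reachable set; the other
   clauses impose the prescribed values on both sides. *)
exists (fun p => (x0 < p.1)%N && ((x0 + k <= p.1)%N || ~~ `[< reach p >])).
have reach_step p q : reach p -> open_step ob k x0 p q -> reach q.
  move=> [v0 [s [v0x ps lp]]] pq; exists v0, (rcons s q).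
  by rewrite rcons_path last_rcons lp pq ps.
have reach0 p : p.1 = x0 -> reach p by move=> px; exists p, [::].
have adjC p q : adj p q -> adj q p.
  by rewrite /adj => /or4P[]->; rewrite ?orbT.
have edgeC p q : adj p q -> edge_of p q = edge_of q p.
  move=> pq; have := adjP pq; have := adjP (adjC _ _ pq).
  case: p q {pq} => [x y] [x' y'] /=.
  case=> -[e ->]; case=> -[e' ->]; move: e e' => [? ?] [? ?];
  by first [congr (_, _, _); lia | exfalso; lia].
(* If this edge were not [b], it would extend the exploration to [q], which is either unreached or
   in the right column. *)
have key p q : adj p q -> (p.2 < k)%N -> (q.2 < k)%N ->
    ((p.1 <= x0)%N || (p.1 < x0 + k)%N && `[< reach p >]) ->
    (x0 < q.1)%N -> ((x0 + k <= q.1)%N || ~~ `[< reach q >]) -> ob (edge_of p q).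
  move=> pq pk qk hp q0 hq; apply: contrapT => /negP nob.
  have /andP[pq1 qp1] : (p.1 <= q.1.+1)%N && (q.1 <= p.1.+1)%N.
    by case: (adjP pq) => -[-> _] /=; lia.
  have px : (x0 <= p.1)%N by lia.
  have rp : reach p.
    by case/orP: hp => [p0|/andP[_ /asboolP]//]; apply: reach0; lia.
  have pxk : (p.1 <= x0 + k)%N by case/orP: hp => [|/andP[]]; lia.
  have qxk : (q.1 <= x0 + k)%N by case/orP: hp => [|/andP[]]; lia.
  have rq : reach q.
    apply: reach_step rp _.
    by rewrite /open_step pq px pxk pk qxk qk (negbTE nob) (ltnW q0).
  case/orP: hq => [qe|/asboolP//]; apply: noreach; exists q; split => //; lia.
split.
- by move=> p px; rewrite ltnNge px.
- move=> p px; rewrite px andbT; rewrite ltn_neqAle.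
  lia.
- move=> p q pq pk qk.
  case hp : (_ && _); case hq : (_ && _) => // _.
    rewrite edgeC//; move: hp => /andP[p0 hp]; apply: key => //; first exact: adjC.
    move/negbT: hq; rewrite negb_and negb_or negbK -leqNgt -ltnNge.
    by [].
  move: hq => /andP[q0 hq]; apply: key => //.
  by move/negbT: hp; rewrite negb_and negb_or negbK -leqNgt -ltnNge.
Qed.

Fixpoint xor_steps (f : nat * nat -> nat * nat -> bool) (p : nat * nat)
    (s : seq (nat * nat)) : bool :=
  if s is q :: s' then f p q (+) xor_steps f q s' else false.

Lemma xor_steps_telescope (chi : nat * nat -> bool) p s :
  xor_steps (fun p q => chi p (+) chi q) p s = chi p (+) chi (last p s).
Proof.
elim: s p => [p|q s IHs p] /=; first by rewrite addbb.
by rewrite IHs addbA addbK.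
Qed.

Lemma xor_stepsD f g p s :
  xor_steps f p s (+) xor_steps g p s = xor_steps (fun p q => f p q (+) g p q) p s.
Proof. by elim: s p => //= q s IHs p; rewrite -IHs addbACA. Qed.

Lemma eq_xor_steps (e : rel (nat * nat)) f g p s :
  path e p s -> (forall p q, e p q -> f p q = g p q) ->
  xor_steps f p s = xor_steps g p s.
Proof.
move=> + fg; elim: s p => //= q s IHs p /andP[pq ps].
by rewrite (fg _ _ pq) IHs.
Qed.

(* Planar duality: the dual of the configuration [ob] is, up to a reflection,
   [ob'].  The function [h] is the parity of the number of times the dual path
   crosses the row of [p] to the left of [p]; it is 1 on the right side because
   the dual path goes from bottom to top, and it only changes across an edge
   that the dual path crosses. *)
Lemma open_path_blocked (ob ob' : nat * nat * bool -> bool) k x0 v0 s :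
  (forall x y, (x < k)%N -> (y < k)%N ->
     ~~ ob ((x0 + y)%N, x, false) -> ob' ((x0 + x)%N, y, false)) ->
  (forall x y, (x.+1 < k)%N -> (y.+1 < k)%N ->
     ~~ ob ((x0 + y.+1)%N, x, true) -> ob' ((x0 + x.+1)%N, y, true)) ->
  v0.1 = x0 -> path (open_step ob k x0) v0 s -> ((last v0 s).2 < k)%N ->
  (last v0 s).1 = (x0 + k)%N -> is_blocked ob' k x0.
Proof.
move=> obH obV v0x pth lk lx.
(* [X x y] detects a step between columns [x0 + y] and [x0 + y + 1] at height below [x - x0]. After
   the reflection, this is a crossing of row [y] to the left of column [x]. *)
pose X x y (p q : nat * nat) :=
  ((p.1 <= x0 + y)%N (+) (q.1 <= x0 + y)%N) && (x0 + p.2 < x)%N.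
pose c x y := xor_steps (X x y) v0 s.
have c_left x y : (x <= x0)%N -> c x y = false.
  move=> xx0; transitivity (xor_steps (fun p q => false (+) false) v0 s).
    apply: eq_xor_steps pth _ => p q _.
    by rewrite /X; apply/negbTE; rewrite negb_and -leqNgt; apply/orP; right; lia.
  by rewrite (xor_steps_telescope (fun=> false)).
have c_right x y : (y < k)%N -> (x0 + k <= x)%N -> c x y = true.
  move=> yk xk.
  transitivity (xor_steps (fun p q => (p.1 <= x0 + y)%N (+) (q.1 <= x0 + y)%N) v0 s).
    apply: eq_xor_steps pth _ => p q /and4P[_ /andP[_ pk] _ _].
    by rewrite /X [X in _ && X](_ : _ = true) ?andbT//; lia.
  by rewrite (xor_steps_telescope (fun p => p.1 <= x0 + y)%N) v0x lx; lia.
(* Passing from [x] to [x.+1] can change the parity only through a horizontal step at height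
   [x - x0]. Such a step of an open path is not [b], so its dual edge is. *)
have cH x y : (y < k)%N -> ~~ ob' (x, y, false) -> c x y = c x.+1 y.
  move=> yk nob; apply: eq_xor_steps pth _ => p q.
  case/and4P=> pq /andP[px pk] /andP[qx qk] opq; rewrite /X.
  have [e|ne] := eqVneq ((p.1 <= x0 + y)%N) ((q.1 <= x0 + y)%N).
    by rewrite e addbb.
  have [xe|] := eqVneq (x0 + p.2)%N x; last by move=> xe; congr (_ && _); lia.
  exfalso; move/negP: nob; apply; rewrite -xe; apply: obH => //.
  move: opq; case: (adjP pq) => -[e ->] opq; move: ne; rewrite e/= => ne; try lia.
  - move: opq; rewrite e /= => /implyP opq; apply/negP.
    have -> : (x0 + y)%N = p.1 by lia.
    move=> /opq; lia.
  - move: opq; rewrite e /= => /implyP opq; apply/negP.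
    have -> : (x0 + y)%N = q.1 by lia.
    move=> /opq; lia.
have cV x y : (y.+1 < k)%N -> (x0 < x < x0 + k)%N -> ~~ ob' (x, y, true) ->
    c x y = c x y.+1.
  move=> yk xb nob.
  (* Contrapositive of [obV]. Since column [x0 + y.+1] is interior, the open path cannot use this
     [b]-edge. *)
  have notob : ob (x0 + y.+1, (x - x0).-1, true)%N.
    apply: contraNT nob => nob.
    have -> : x = (x0 + (x - x0).-1.+1)%N by lia.
    by apply: obV => //; lia.
  suff: c x y (+) c x y.+1 = false by case: (c x y); case: (c x y.+1).
  rewrite xor_stepsD.
  (* Steps counted for exactly one of the rows [y] and [y.+1] enter or leave column [x0 + y.+1]
     below height [x - x0]. They are the changes of [Rg], since the only vertical edge through which
     [Rg] could change is excluded. The sum telescopes to 0 because both ends of the path lie in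
     extreme columns. *)
  pose Rg (p : nat * nat) := (p.1 == x0 + y.+1)%N && (x0 + p.2 < x)%N.
  transitivity (xor_steps (fun p q => Rg p (+) Rg q) v0 s); last first.
    by rewrite xor_steps_telescope /Rg v0x lx; lia.
  apply: eq_xor_steps pth _ => p q.
  case/and4P=> pq /andP[px pk] /andP[qx qk]; rewrite /X /Rg.
  case: (adjP pq) => -[e ->]; rewrite e/=; try lia.
  - have [/andP[/eqP e1 /eqP e2]|] :=
      boolP ((p.1 == x0 + y.+1) && (x0 + p.2.+1 == x))%N; last by lia.
    have -> : (p.1, p.2) = (x0 + y.+1, (x - x0).-1)%N by congr (_, _); lia.
    rewrite notob; lia.
  - have [/andP[/eqP e1 /eqP e2]|] :=
      boolP ((q.1 == x0 + y.+1) && (x0 + q.2.+1 == x))%N; last by lia.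
    have -> : (q.1, q.2) = (x0 + y.+1, (x - x0).-1)%N by congr (_, _); lia.
    rewrite notob; lia.
pose h p := (x0 < p.1)%N && ((x0 + k <= p.1)%N || c p.1 p.2).
have hc p : (p.2 < k)%N -> h p = c p.1 p.2.
  move=> pk; rewrite /h; have [p0|p0] := leqP p.1 x0; first by rewrite c_left.
  by have [pk'|//] := leqP (x0 + k) p.1; rewrite c_right.
exists h; split.
- by move=> p p0; rewrite /h ltnNge p0.
- by move=> p pk; rewrite /h pk andbT; lia.
- move=> p q pq pk qk; rewrite !hc//; apply: contraNT.
  case: (adjP pq) => -[e ->] nob; rewrite e/=; apply/eqP.
  + by apply: cH.
  + by apply/esym/cH.
  + have [x_l|x_l] := leqP p.1 x0; first by rewrite !c_left.
    have [x_r|x_r] := leqP (x0 + k) p.1; first by rewrite !c_right//; move: qk; rewrite e.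
    by apply: cV => //; [move: qk; rewrite e|lia].
  + have [x_l|x_l] := leqP q.1 x0; first by rewrite !c_left.
    have [x_r|x_r] := leqP (x0 + k) q.1; first by rewrite !c_right//; move: pk; rewrite e.
    by apply/esym; apply: cV => //; [move: pk; rewrite e|lia].
Qed.

(** * Noise and small sets *)

Definition unif {R : realType} (E : finType) (_ : E) (_ : bool) : R := 2^-1.

Definition noise_law {R : realType} (eps : R) (E : finType) (_ : E) (v : bool * bool) : R :=
  rho eps v.1 v.2.

Definition prob {R : realType} (E : finType) (A : pred {ffun E -> bool}) : R :=
  EE (@unif R E) (fun w => (A w)%:R).

Definition corr {R : realType} (eps : R) (E : finType) (f g : {ffun E -> bool} -> R) : R :=
  EE (@noise_law R eps E) (fun z => f (map_cfg fst z) * g (map_cfg snd z)).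

Section Noise.
Variables (R : realType) (E : finType).
Implicit Types (A B : pred {ffun E -> bool}) (eps : R).
Local Notation cfgE := {ffun E -> bool}.

Lemma rhoE eps x y : rho eps x y = if x == y then 2^-1 - eps / 4 else eps / 4.
Proof. by rewrite /rho; case: eqP => _ /=; rewrite ?mulr1 ?mulr0; lra. Qed.

Lemma unif_sum1 (e : E) : \sum_v unif e v = 1 :> R.
Proof. by rewrite big_bool/= /unif; lra. Qed.

Lemma unif_ge0 (e : E) v : 0 <= unif e v :> R.
Proof. by rewrite invr_ge0. Qed.

Lemma noise_law_sum1 eps (e : E) : \sum_v noise_law eps e v = 1.
Proof.
rewrite /noise_law -(pair_bigA _ (fun x y : bool => rho eps x y))/=.
by rewrite !big_bool /= !rhoE/=; lra.
Qed.

Lemma noise_law_ge0 eps (e : E) v : 0 <= eps <= 1 -> 0 <= noise_law eps e v.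
Proof.
move=> /andP[e0 e1]; rewrite /noise_law /rho.
by apply: addr_ge0; [apply: mulr_ge0; [lra|exact: ler0n]|lra].
Qed.

Lemma corr_marginal1 eps (f : cfgE -> R) : corr eps f (fun=> 1) = EE (@unif R E) f.
Proof.
rewrite -(@EE_marginal _ _ _ _ (@noise_law R eps E) (@unif R E) fst).
  by apply: EE_eq => z; rewrite mulr1.
move=> e v'; rewrite /noise_law big_mkcond.
rewrite -(pair_bigA _ (fun x y : bool => if x == v' then rho eps x y else 0))/=.
by rewrite !big_bool /= !rhoE /unif; case: v' => /=; lra.
Qed.

Lemma corr_marginal2 eps (f : cfgE -> R) : corr eps (fun=> 1) f = EE (@unif R E) f.
Proof.
rewrite -(@EE_marginal _ _ _ _ (@noise_law R eps E) (@unif R E) snd).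
  by apply: EE_eq => z; rewrite mul1r.
move=> e v'; rewrite /noise_law big_mkcond.
rewrite -(pair_bigA _ (fun x y : bool => if y == v' then rho eps x y else 0))/=.
by rewrite !big_bool /= !rhoE /unif; case: v' => /=; lra.
Qed.

(** Configurations of pairs correspond to pairs of configurations. The left side is a product
    expectation, to which independence applies; the right side is the double sum of [noise_corr]. *)
Lemma corrE eps (f g : cfgE -> R) :
  corr eps f g =
  \sum_(w : cfgE) \sum_(w' : cfgE) (\prod_e rho eps (w e) (w' e)) * f w * g w'.
Proof.
rewrite pair_bigA/= /corr /EE.
pose pr (p : cfgE * cfgE) : {ffun E -> bool * bool} := [ffun e => (p.1 e, p.2 e)].
pose un (z : {ffun E -> bool * bool}) : cfgE * cfgE := (map_cfg fst z, map_cfg snd z).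
have prK : cancel pr un.
  by move=> [w w']; congr pair; apply/ffunP => e; rewrite !ffunE.
have unK : cancel un pr.
  by move=> z; apply/ffunP => e; rewrite !ffunE; case: (z e).
rewrite (reindex pr)/=; last by exists un => p _; [exact: prK|exact: unK].
apply: eq_bigr => p _; rewrite mulrA.
have [-> ->] : map_cfg fst (pr p) = p.1 /\ map_cfg snd (pr p) = p.2.
  by have := prK p; case: p => w w' [-> ->].
by congr (_ * _ * _); apply: eq_bigr => e _; rewrite /noise_law ffunE.
Qed.

Lemma unif_EE (f : cfgE -> R) : EE (@unif R E) f = 2^-1 ^+ #|E| * \sum_w f w.
Proof.
by rewrite /EE big_distrr/=; apply: eq_bigr => w _; rewrite prodr_const.
Qed.

Lemma prob_ge0 A : 0 <= prob A :> R.
Proof. by apply: EE_ge0 => [e v|w]; [exact: unif_ge0|exact: ler0n]. Qed.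

Lemma corr_ge0 eps A B : 0 <= eps <= 1 ->
  0 <= corr eps (fun w => (A w)%:R) (fun w => (B w)%:R) :> R.
Proof.
move=> eps01; apply: EE_ge0 => [e v|z]; first exact: noise_law_ge0.
by rewrite mulr_ge0.
Qed.

Lemma corrN eps A :
  corr eps (fun w => 1 - (A w)%:R) (fun w => 1 - (A w)%:R) =
  1 - 2 * prob A + corr eps (fun w => (A w)%:R) (fun w => (A w)%:R) :> R.
Proof.
pose f w : R := (A w)%:R; pose one (w : cfgE) : R := 1.
transitivity (corr eps one one + -1 * corr eps f one + -1 * corr eps one f + corr eps f f).
  by rewrite /corr -!EEZ -!EED; apply: EE_eq => z; rewrite /one /f; ring.
rewrite {}/one !corr_marginal1 corr_marginal2 (EE_cst unif_sum1) /prob -/f; ring.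
Qed.

Lemma corrN_itv eps A : 0 <= eps <= 1 ->
  0 <= (1 - 2 * prob A + corr eps (fun w => (A w)%:R) (fun w => (A w)%:R) : R) <= 1.
Proof.
move=> eps01; rewrite -corrN.
have A01 w : 0 <= (1 - (A w)%:R : R) <= 1.
  by case: (A w); rewrite ?subrr ?subr0 ?lexx ?ler01.
apply/andP; split.
  apply: EE_ge0 => [e v|z]; first exact: noise_law_ge0.
  by apply: mulr_ge0; [case/andP: (A01 (map_cfg fst z))|case/andP: (A01 (map_cfg snd z))].
rewrite -[leRHS](EE_cst (noise_law_sum1 eps)).
apply: EE_le => [e v|z]; first exact: noise_law_ge0.
case/andP: (A01 (map_cfg fst z)) => f0 f1; case/andP: (A01 (map_cfg snd z)) => g0 g1.
exact: mulr_ile1.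
Qed.

Lemma prob_le1 A : prob A <= 1 :> R.
Proof.
rewrite -[leRHS](EE_cst unif_sum1).
by apply: EE_le => [|w]; [exact: unif_ge0|rewrite lern1 leq_b1].
Qed.

Lemma prob_compl A B : (forall w, A w = ~~ B w) -> prob A = 1 - prob B :> R.
Proof.
move=> AB; transitivity (EE (@unif R E) (fun=> 1) + -1 * prob B : R).
  by rewrite /prob -EEZ -EED; apply: EE_eq => w; rewrite AB; case: (B w) => /=; ring.
by rewrite (EE_cst unif_sum1) mulN1r.
Qed.

(* The 3/2-norm hypercontractive estimate for one bit, cleared of roots by taking
   [a ^+ 3], [b ^+ 3], [c ^+ 3], [d ^+ 3] as conditional probabilities. *)
Lemma two_point_hypercontractive (eps a b c d : R) :
  2^-1 <= eps <= 1 -> 0 <= a -> 0 <= b -> 0 <= c -> 0 <= d ->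
  ((1 - eps) * (a ^+ 2 * c ^+ 2 + b ^+ 2 * d ^+ 2) / 2
    + eps * ((a ^+ 2 + b ^+ 2) / 2) * ((c ^+ 2 + d ^+ 2) / 2)) ^+ 3 <=
  ((a ^+ 3 + b ^+ 3) / 2) ^+ 2 * ((c ^+ 3 + d ^+ 3) / 2) ^+ 2.
Proof.
move=> /andP[e0 e1] a0 b0 c0 d0; set B := (X in X ^+ 3).
(* Squared mean plus [1 - eps] times the squared half-difference of [x ^+ 2] and [y ^+ 2], that is,
   the quadratic form whose polarization is [B]. Cauchy-Schwarz ([B_CS]) reduces the claim to one
   pair of values. *)
pose Q (x y : R) := ((x ^+ 2 + y ^+ 2) / 2) ^+ 2 + (1 - eps) * ((x ^+ 2 - y ^+ 2) / 2) ^+ 2.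
have Q_ge0 x y : 0 <= Q x y.
  by apply: addr_ge0; [|apply: mulr_ge0; [lra|]]; exact: sqr_ge0.
have Q_le x y : 0 <= x -> 0 <= y -> Q x y ^+ 3 <= (((x ^+ 3 + y ^+ 3) / 2) ^+ 2) ^+ 2.
  move=> x0 y0.
  (* In these variables both sides are polynomials with [0 <= S <= P], and [2^-1 <= eps] bounds [Q]
     by its value at [eps = 2^-1]. *)
  pose P := ((x + y) / 2) ^+ 2; pose S := ((x - y) / 2) ^+ 2.
  have P0 : 0 <= P := sqr_ge0 _.
  have S0 : 0 <= S := sqr_ge0 _.
  have SP : S <= P by rewrite -subr_ge0 (_ : P - S = x * y) ?mulr_ge0// /P /S; field.
  have QP : Q x y <= P ^+ 2 + 4 * P * S + S ^+ 2.
    have -> : P ^+ 2 + 4 * P * S + S ^+ 2 =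
      Q x y + (eps - 2^-1) * ((x ^+ 2 - y ^+ 2) / 2) ^+ 2 by rewrite /P /S /Q; field.
    by rewrite lerDl; apply: mulr_ge0; [lra|exact: sqr_ge0].
  have -> : (((x ^+ 3 + y ^+ 3) / 2) ^+ 2) ^+ 2 = P ^+ 2 * (P + 3 * S) ^+ 4.
    by rewrite /P /S; field.
  apply: le_trans (_ : (P ^+ 2 + 4 * P * S + S ^+ 2) ^+ 3 <= _).
    by rewrite lerXn2r ?nnegrE// (le_trans (Q_ge0 x y)).
  rewrite -subr_ge0.
  have -> : P ^+ 2 * (P + 3 * S) ^+ 4 - (P ^+ 2 + 4 * P * S + S ^+ 2) ^+ 3 =
    S ^+ 2 * (3 * P ^+ 4 + 20 * (P ^+ 3 * S) + 17 * (P * S) ^+ 2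
      + (P - S) * S * (13 * P * S + S ^+ 2)) by ring.
  have PS0 : 0 <= P - S by rewrite subr_ge0.
  have [P3 P4 S2 PS1] : [/\ 0 <= P ^+ 3, 0 <= P ^+ 4, 0 <= S ^+ 2 & 0 <= P * S].
    by split; do ?exact: exprn_ge0; exact: mulr_ge0.
  apply: mulr_ge0 => //; apply: addr_ge0.
    by have := mulr_ge0 P3 S0; have := sqr_ge0 (P * S); lra.
  apply: mulr_ge0; first exact: mulr_ge0.
  by rewrite addr_ge0// -mulrA mulr_ge0.
have B_CS : B ^+ 2 <= Q a b * Q c d.
  rewrite -subr_ge0.
  have -> : Q a b * Q c d - B ^+ 2 = (1 - eps) *
      ((a ^+ 2 + b ^+ 2) / 2 * ((c ^+ 2 - d ^+ 2) / 2)
       - (a ^+ 2 - b ^+ 2) / 2 * ((c ^+ 2 + d ^+ 2) / 2)) ^+ 2.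
    by rewrite /Q /B; field.
  by apply: mulr_ge0; [lra|exact: sqr_ge0].
rewrite -(@ler_pXn2r _ 2%N)// ?nnegrE.
- rewrite exprAC (le_trans (_ : _ <= (Q a b * Q c d) ^+ 3))//.
    by rewrite lerXn2r ?nnegrE ?sqr_ge0 ?mulr_ge0.
  rewrite exprMn [leRHS]exprMn; apply: ler_pM; do ?exact: exprn_ge0.
    exact: Q_le.
  exact: Q_le.
- apply: exprn_ge0; apply: addr_ge0; last first.
    have ab : 0 <= (a ^+ 2 + b ^+ 2) / 2 by rewrite divr_ge0 ?addr_ge0 ?exprn_ge0.
    have cd : 0 <= (c ^+ 2 + d ^+ 2) / 2 by rewrite divr_ge0 ?addr_ge0 ?exprn_ge0.
    by apply: mulr_ge0 => //; apply: mulr_ge0 => //; lra.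
  apply: divr_ge0 => //; apply: mulr_ge0; first lra.
  by rewrite addr_ge0 ?mulr_ge0 ?exprn_ge0.
- by apply: mulr_ge0; apply: sqr_ge0.
Qed.

Lemma map_upd (V V' : finType) (f : V -> V') (z : {ffun E -> V}) e v :
  map_cfg f (upd z e v) = upd (map_cfg f z) e (f v).
Proof. by apply/ffunP => e'; rewrite !ffunE; case: eqP. Qed.

Lemma corr_cond eps e (f g : cfgE -> R) :
  corr eps f g = \sum_x \sum_y rho eps x y *
     corr eps (fun w => f (upd w e x)) (fun w => g (upd w e y)).
Proof.
rewrite [LHS](EE_cond (noise_law_sum1 eps) e) pair_bigA/=.
by apply: eq_bigr => -[x y] _ /=; congr (_ * _); apply: EE_eq => z; rewrite !map_upd.
Qed.

Lemma prob_cond e A :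
  prob A = \sum_x 2^-1 * prob (fun w => A (upd w e x)) :> R.
Proof. exact: (EE_cond unif_sum1 e). Qed.

Lemma depends_on_upd (T : Type) D (F : cfgE -> T) e x : depends_on D F ->
  depends_on (predD1 D e) (fun w => F (upd w e x)).
Proof.
move=> FD w w' ww'; apply: FD => e' e'D; rewrite !ffunE.
by case: eqP => // /eqP ne; apply: ww'; rewrite inE /= ne.
Qed.

Lemma cube_root (x : R) : 0 <= x -> exists2 y, 0 <= y & x = y ^+ 3.
Proof.
move=> x0; exists (x `^ 3^-1); first exact: powR_ge0.
by rewrite -powR_mulrn ?powR_ge0// -powRrM mulVf// powRr1.
Qed.

(** Tensorization: induction on the number of coordinates on which [A] and [B] depend, with the
    two-point inequality as inductive step. It is the bound of the correlation by the power 2/3 of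
    the product of probabilities, cleared of roots. *)
Lemma corr_small_set eps A B : 2^-1 <= eps <= 1 ->
  corr eps (fun w => (A w)%:R) (fun w => (B w)%:R) ^+ 3 <=
  prob A ^+ 2 * prob B ^+ 2 :> R.
Proof.
move=> /andP[e0 e1].
have eps01 : 0 <= eps <= 1 by lra.
suff H D : depends_on D A -> depends_on D B ->
    corr eps (fun w => (A w)%:R) (fun w => (B w)%:R) ^+ 3 <=
    prob A ^+ 2 * prob B ^+ 2 :> R.
  apply: (H predT) => w w' ww'; congr (_ _); apply/ffunP => e; exact: ww'.
have [d] := ubnP #|D|; elim: d => // d IHd in D A B *; rewrite ltnS => Dd AD BD.
case: (pickP D) => [e eD|D0]; last first.
  have cst (C : pred cfgE) : depends_on D C -> forall w, C w = C [ffun=> true].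
    by move=> CD w; apply: CD => e; rewrite unfold_in D0.
  have -> : corr eps (fun w => (A w)%:R) (fun w => (B w)%:R) =
      (A [ffun=> true])%:R * (B [ffun=> true])%:R.
    rewrite -[RHS](EE_cst (noise_law_sum1 eps)); apply: EE_eq => z.
    by rewrite (cst A)// (cst B).
  have pcst (C : pred cfgE) : depends_on D C -> prob C = (C [ffun=> true])%:R :> R.
    move=> CD; rewrite -[RHS](EE_cst unif_sum1); apply: EE_eq => z.
    by rewrite (cst C).
  rewrite !pcst//; case: (A _); case: (B _);
    by rewrite ?(mulr0, mulr1, mul0r) ?expr1n ?expr0n/= ?(mulr0,mul0r,mulr1).
have De : (#|predD1 D e| < d)%N.
  by apply: leq_trans Dd; rewrite [leqRHS](cardD1 e) unfold_in eD.
pose Ax x w := A (upd w e x); pose Bx x w := B (upd w e x).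
have [a0 a0_ge0 Ea0] := cube_root (prob_ge0 (Ax true)).
have [a1 a1_ge0 Ea1] := cube_root (prob_ge0 (Ax false)).
have [b0 b0_ge0 Eb0] := cube_root (prob_ge0 (Bx true)).
have [b1 b1_ge0 Eb1] := cube_root (prob_ge0 (Bx false)).
(* With cube roots of the conditional probabilities, the induction hypothesis takes the form
   required by the two-point inequality. *)
have step x y a b : 0 <= a -> 0 <= b -> prob (Ax x) = a ^+ 3 -> prob (Bx y) = b ^+ 3 ->
    corr eps (fun w => (Ax x w)%:R) (fun w => (Bx y w)%:R) <= a ^+ 2 * b ^+ 2.
  move=> a_ge0 b_ge0 Ea Eb.
  rewrite -(@ler_pXn2r _ 3%N)// ?nnegrE ?corr_ge0 ?mulr_ge0 ?exprn_ge0//.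
  apply: le_trans (IHd _ _ _ De (depends_on_upd _ AD) (depends_on_upd _ BD)) _.
  by rewrite -/(Ax x) -/(Bx y) Ea Eb; rewrite le_eqVlt; apply/orP; left; apply/eqP; ring.
rewrite (prob_cond e A) (prob_cond e B) !big_bool/=.
rewrite -!/(Ax _) -!/(Bx _) Ea0 Ea1 Eb0 Eb1.
apply: le_trans (_ : _ <= ((1 - eps) * (a0 ^+ 2 * b0 ^+ 2 + a1 ^+ 2 * b1 ^+ 2) / 2
    + eps * ((a0 ^+ 2 + a1 ^+ 2) / 2) * ((b0 ^+ 2 + b1 ^+ 2) / 2)) ^+ 3) _; last first.
  rewrite -!mulrDr ![2^-1 * _]mulrC; by apply: two_point_hypercontractive => //; rewrite e0.
set X := (X in _ <= X ^+ 3).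
suff cX : corr eps (fun w => (A w)%:R) (fun w => (B w)%:R) <= X.
  by rewrite lerXn2r ?nnegrE ?(le_trans _ cX) ?corr_ge0.
rewrite /X (corr_cond _ e) !big_bool/= !rhoE/=.
have s00 := step true true _ _ a0_ge0 b0_ge0 Ea0 Eb0.
have s01 := step true false _ _ a0_ge0 b1_ge0 Ea0 Eb1.
have s10 := step false true _ _ a1_ge0 b0_ge0 Ea1 Eb0.
have s11 := step false false _ _ a1_ge0 b1_ge0 Ea1 Eb1.
have r0 : 0 <= 2^-1 - eps / 4 by lra.
have r1 : 0 <= eps / 4 by lra.
apply: le_trans (lerD (lerD (ler_wpM2l r0 s00) (ler_wpM2l r1 s01))
   (lerD (ler_wpM2l r1 s10) (ler_wpM2l r0 s11))) _.
rewrite le_eqVlt; apply/orP; left; apply/eqP; by field.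
Qed.

Lemma sum_CauchySchwarz (I : finType) (f g : I -> R) :
  (\sum_i f i * g i) ^+ 2 <= (\sum_i f i ^+ 2) * (\sum_i g i ^+ 2).
Proof.
set fg := \sum_i _; set ff := \sum_i f i ^+ 2; set gg := \sum_i g i ^+ 2.
have : 0 <= \sum_i (gg * f i - fg * g i) ^+ 2 by apply: sumr_ge0 => i _; exact: sqr_ge0.
have -> : \sum_i (gg * f i - fg * g i) ^+ 2 = gg ^+ 2 * ff - 2 * gg * fg * fg + fg ^+ 2 * gg.
  transitivity (\sum_i (gg ^+ 2 * f i ^+ 2 - 2 * gg * fg * (f i * g i) + fg ^+ 2 * g i ^+ 2)).
    by apply: eq_bigr => i _; ring.
  by rewrite big_split/= sumrB -!big_distrr.
have -> : gg ^+ 2 * ff - 2 * gg * fg * fg + fg ^+ 2 * gg = gg * (ff * gg - fg ^+ 2) by ring.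
have gg_ge0 : 0 <= gg by apply: sumr_ge0 => i _; exact: sqr_ge0.
have [gg0|gg_gt0] := leP gg 0; last by rewrite pmulr_rge0// subr_ge0.
move=> _; have {gg0 gg_ge0}gg0 : gg = 0 by apply/le_anti; rewrite gg0 gg_ge0.
rewrite gg0 mulr0 /fg big1 ?expr0n// => i _.
move/eqP: gg0; rewrite psumr_eq0 => [/allP/(_ i)|j _]; last exact: sqr_ge0.
by rewrite mem_index_enum sqrf_eq0 => /(_ isT)/eqP ->; rewrite mulr0.
Qed.

(** Noise acts as a symmetric operator [T], and applying it twice is noise of level
    [1 - (1 - eps) ^+ 2]. Cauchy-Schwarz bounds the square of the product of [1_A] and [T 1_A] by
    the squared norm of [1_A] times that of [T 1_A]. *)
Lemma corr_CauchySchwarz eps A :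
  corr eps (fun w => (A w)%:R) (fun w => (A w)%:R) ^+ 2 <=
  prob A * corr (1 - (1 - eps) ^+ 2) (fun w => (A w)%:R) (fun w => (A w)%:R) :> R.
Proof.
pose K eps (w w' : cfgE) := \prod_e rho eps (w e) (w' e).
pose f w : R := (A w)%:R.
have corrK x : corr x f f = \sum_w f w * (\sum_w' K x w w' * f w').
  rewrite corrE; apply: eq_bigr => w _; rewrite big_distrr/=; apply: eq_bigr => w' _.
  by rewrite mulrAC mulrC mulrCA.
rewrite {1}corrK; apply: le_trans (sum_CauchySchwarz _ _) _.
rewrite le_eqVlt; apply/orP; left; apply/eqP.
(* Composition of noises, edge by edge; the power of [2^-1] appears because [rho] is a joint law and
   not a transition kernel. *)
have KK w w' : \sum_x K eps x w * K eps x w' = 2^-1 ^+ #|E| * K (1 - (1 - eps) ^+ 2) w w'.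
  rewrite -prodr_const /K -big_split/=.
  transitivity (\prod_e \sum_x rho eps x (w e) * rho eps x (w' e)).
    by rewrite bigA_distr_bigA; apply: eq_bigr => x _; rewrite -big_split.
  apply: eq_bigr => e _; rewrite big_bool/= !rhoE.
  by case: (w e); case: (w' e) => /=; field.
have -> : \sum_w (\sum_w' K eps w w' * f w') ^+ 2 =
    2^-1 ^+ #|E| * corr (1 - (1 - eps) ^+ 2) f f.
  rewrite corrE big_distrr/=.
  under eq_bigr do rewrite expr2 big_distrlr/=.
  rewrite exchange_big/=; apply: eq_bigr => w _.
  rewrite exchange_big/= big_distrr/=; apply: eq_bigr => w' _.
  rewrite !mulrA -/(K _ w w') -KK !big_distrl/=; apply: eq_bigr => x _.
  by ring.
rewrite mulrA; congr (_ * _); rewrite /prob unif_EE mulrC; congr (_ * _).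
by apply: eq_bigr => w _; rewrite /f; case: (A w); rewrite ?expr1n ?expr0n.
Qed.

End Noise.

(** The correlation is at most the power [1 + 1 / c] of the probability, with [c] depending on [eps]
    only. Cauchy-Schwarz is iterated until the noise level exceeds one half, where [corr_small_set]
    gives [c = 3]. *)
Lemma corr_prob_bound (R : realType) (eps : R) : 0 < eps <= 1 ->
  exists2 c : nat, (0 < c)%N & forall (E : finType) (A : pred {ffun E -> bool}),
    corr eps (fun w => (A w)%:R) (fun w => (A w)%:R) ^+ c <= prob A ^+ c.+1.
Proof.
move=> /andP[e0 e1].
have [j] : exists j : nat, (1 - eps) ^+ j < 2^-1.
  have : (fun j => (1 - eps) ^+ j) @ \oo --> (0 : R).
    by apply: cvg_expr; rewrite ger0_norm; lra.
  move=> /cvgrPdist_lt/(_ 2^-1 ltac:(lra)) [N _ /(_ N (leqnn _))].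
  by rewrite /= sub0r normrN ger0_norm ?exprn_ge0 ?subr_ge0// => ?; exists N.
have [m jm] : exists m, (j <= 2 ^ m)%N by exists j; exact/ltnW/ltn_expl.
move=> ej; have {ej jm j} : (1 - eps) ^+ (2 ^ m) <= 2^-1.
  by apply: le_trans (ltW ej); apply: ler_wiXn2l => //; lra.
elim: m eps e0 e1 => [|m IHm] eps e0 e1.
  rewrite expn0 expr1 => e2; exists 3%N => // E A.
  apply: le_trans (corr_small_set A A _) _; first lra.
  by rewrite -exprD.
set eps' := 1 - (1 - eps) ^+ 2.
rewrite expnS exprM => em.
have e1e : (1 - eps) ^+ 2 < 1 by rewrite expr_lt1 //; lra.
have e2e : 0 <= (1 - eps) ^+ 2 by exact: sqr_ge0.
have [||//|c c0 Hc] := IHm eps'; rewrite /eps'; try lra.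
  by rewrite opprB addrC subrK.
(* Each use of Cauchy-Schwarz doubles [c]: the exponents of [prob A] add up to
   [c + c.+1 = (2 * c).+1]. *)
exists (2 * c)%N => [|E A]; first lia.
have p0 := prob_ge0 R A.
rewrite exprM;
  apply: le_trans (_ : (prob A * corr eps' (fun w => (A w)%:R) (fun w => (A w)%:R)) ^+ c <= _).
  by rewrite lerXn2r ?nnegrE ?sqr_ge0 ?corr_CauchySchwarz// mulr_ge0 ?corr_ge0// /eps'; lra.
rewrite exprMn; apply: le_trans (ler_wpM2l _ (Hc E A)) _; first exact: exprn_ge0.
by rewrite -exprD addnS mul2n addnn.
Qed.

(** * Crossings *)

Lemma edge_of_coord p q : (edge_of p q).1 = p \/ (edge_of p q).1 = q.
Proof.
by case: p q => [x y] [x' y']; rewrite /edge_of /=; do ![case: ifP => _]; tauto.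
Qed.

Lemma path_zip (T : eqType) (e : rel T) (P : pred T) v s p q :
  path e v s -> all P (v :: s) -> (p, q) \in zip (v :: s) s ->
  [/\ e p q, P p & P q].
Proof.
elim: s v => //= u s IHs v /andP[vu us] /and3P[Pv Pu Ps].
rewrite inE => /orP[/eqP[-> ->]//|].
by apply: IHs => //=; rewrite Pu.
Qed.

Lemma zip_change (h : nat * nat -> bool) v s : h v != h (last v s) ->
  exists2 pq, pq \in zip (v :: s) s & h pq.1 != h pq.2.
Proof.
elim: s v => [|u s IHs] v /=; first by rewrite eqxx.
have [vu|vu _] := eqVneq (h v) (h u).
  rewrite vu => /IHs[pq pq_in hpq]; exists pq => //.
  by rewrite inE pq_in orbT.
by exists (v, u); rewrite ?mem_head.
Qed.

Lemma strip_edge (h : nat * nat -> bool) k x0 p q :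
  (forall p, (p.1 <= x0)%N -> h p = false) ->
  (forall p, (x0 + k <= p.1)%N -> h p = true) ->
  adj p q -> h p != h q -> (x0 <= (edge_of p q).1.1 < x0 + k)%N.
Proof.
move=> h0 h1 pq hpq; apply: contraNT hpq; rewrite negb_and -ltnNge -leqNgt => out.
apply/eqP; move: out; case: (adjP pq) => -[-> ->] /= /orP[] ?;
  by first [rewrite !h0 //=; lia | rewrite !h1 //=; lia].
Qed.

Lemma div_strip k j x : (0 < k)%N -> (j * k <= x < j * k + k)%N -> (x %/ k = j)%N.
Proof.
move=> k0 /andP[jx xj]; apply/eqP; rewrite eqn_leq -ltnS ltn_divLR// leq_divRL//.
by rewrite jx mulSn addnC xj.
Qed.

(** * Crossing times as functions of finite configurations *)

Section Configurations.
Variables (R : realType) (a b : R) (n : nat).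
Local Notation edge := ('I_n.+1 * 'I_n.+1 * bool)%type.
Implicit Types (w : cfg n) (e : nat * nat * bool).

Definition edge_ord e : edge := (inord e.1.1, inord e.1.2, e.2).
Definition edge_nat (e : edge) : nat * nat * bool := (e.1.1 : nat, e.1.2 : nat, e.2).

Lemma edge_natK : cancel edge_nat edge_ord.
Proof. by move=> [[x y] d]; rewrite /edge_ord /= !inord_val. Qed.

Lemma edge_ordK e : (e.1.1 <= n)%N -> (e.1.2 <= n)%N -> edge_nat (edge_ord e) = e.
Proof. by case: e => [[x y] d] /= xn yn; rewrite /edge_nat /= !inordK. Qed.

Definition is_b w e : bool := w (edge_ord e).

Lemma envE w x y d : (x <= n)%N -> (y <= n)%N ->
  env a b w x y d = if is_b w (x, y, d) then b else a.
Proof.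
move=> xn yn.
have insubE z : (z <= n)%N -> insub z = Some (inord z : 'I_n.+1).
  by move=> zn; rewrite insubT; congr Some; apply/val_inj; rewrite /= inordK.
by rewrite /env !insubE.
Qed.

Lemma step_wE w p q : (p.1 <= n)%N -> (p.2 <= n)%N -> (q.1 <= n)%N -> (q.2 <= n)%N ->
  step_w (env a b w) p q = if is_b w (edge_of p q) then b else a.
Proof.
move=> p1 p2 q1 q2; rewrite /step_w /edge_of.
by do ![case: eqP => _; first exact: envE]; exact: envE.
Qed.

Definition rows i k : {pred edge} := [pred e : edge | (i <= e.1.2)%N && (e.1.2 < i + k)%N].

Lemma crossing_step i k v s p q : (i + k <= n.+1)%N -> crossing n k i v s ->
  (p, q) \in zip (v :: s) s ->
  [/\ adj p q, edge_nat (edge_ord (edge_of p q)) = edge_of p q,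
      edge_ord (edge_of p q) \in rows i k &
      forall w, step_w (env a b w) p q = if is_b w (edge_of p q) then b else a].
Proof.
move=> ikn /and4P[ps rs _ _] /(path_zip ps rs)[pq].
move=> /and3P[p1 p2 p3] /and3P[q1 q2 q3].
have [h1 h2] : ((edge_of p q).1.1 <= n)%N /\ (i <= (edge_of p q).1.2 < i + k)%N.
  by have [->|->] := edge_of_coord p q; lia.
split=> //; first by rewrite edge_ordK//; lia.
- by rewrite unfold_in /= inordK//; lia.
- by move=> w; apply: step_wE => //; lia.
Qed.

Lemma path_time_depends i k v s w w' : (i + k <= n.+1)%N -> crossing n k i v s ->
  {in rows i k, w =1 w'} ->
  path_time (env a b w) v s = path_time (env a b w') v s.
Proof.
move=> ikn cs ww'; rewrite /path_time big_seq [RHS]big_seq.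
apply: eq_bigr => -[p q] /(crossing_step ikn cs)[_ _ er stepE] /=.
by rewrite !stepE /is_b ww'.
Qed.

Lemma t_cross_depends i k : (i + k <= n.+1)%N ->
  depends_on (rows i k) (fun w => t_cross (env a b w) n k i).
Proof.
move=> ikn w w' ww'; congr inf; apply/seteqP; split => x /= [v [s [cs ->]]];
  exists v, s; split => //; apply: (path_time_depends ikn cs) => // e /ww'.
by [].
Qed.

(** The shift is cyclic so as to permute all edges and preserve the product law; no row of a
    rectangle that fits wraps around. *)
Definition shift_edge (j : nat) (e : edge) : edge :=
  (e.1.1, inord ((e.1.2 + j) %% n.+1)%N, e.2).

Definition shift_rows (j : nat) w : cfg n := [ffun e => w (shift_edge j e)].

Lemma shift_edge_inj j : injective (shift_edge j).
Proof.
move=> [[x y] d] [[x' y'] d'] [-> yy' ->]; congr (_, _, _); apply/val_inj => /=.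
have /eqP := congr1 (fun i : 'I_n.+1 => i : nat) yy'.
by rewrite !inordK ?ltn_pmod// eqn_modDr !modn_small// => /eqP.
Qed.

Lemma t_cross_shift j k w : (j + k <= n.+1)%N ->
  t_cross (env a b w) n k j = t_cross (env a b (shift_rows j w)) n k 0.
Proof.
move=> jkn.
pose up (p : nat * nat) := (p.1, (p.2 + j)%N).
pose dn (p : nat * nat) := (p.1, (p.2 - j)%N).
have adj_up p q : adj (up p) (up q) = adj p q.
  by rewrite /adj /up /= !xpair_eqE !eqE /=; case: p q => ? ? [? ?] /=; lia.
have rect_up p : in_rect n k j (up p) = in_rect n k 0 p.
  by rewrite /in_rect /up /=; lia.
have edge_up p q : edge_of (up p) (up q) =
    ((edge_of p q).1.1, ((edge_of p q).1.2 + j)%N, (edge_of p q).2).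
  rewrite /edge_of /up /= !xpair_eqE -!addSn !eqn_add2r.
  case: p q => ? ? [? ?] /=; rewrite !xpair_eqE.
  by do ![case: ifP => _].
have cross_up v s : crossing n k j (up v) (map up s) = crossing n k 0 v s.
  rewrite /crossing path_map (eq_path (e' := adj)) => [|p q]; last exact: adj_up.
  rewrite -map_cons all_map (eq_all (a2 := in_rect n k 0)) => [|p]; last exact: rect_up.
  by rewrite last_map.
have time_up v s : crossing n k 0 v s ->
    path_time (env a b w) (up v) (map up s) = path_time (env a b (shift_rows j w)) v s.
  move=> cs; rewrite /path_time -map_cons.
  have zip_up : zip (map up (v :: s)) (map up s) =
      map (fun pq => (up pq.1, up pq.2)) (zip (v :: s) s).
    by elim: s v {cs} => //= u s IHs v; rewrite -IHs.
  rewrite zip_up big_map big_seq [RHS]big_seq; apply: eq_bigr => -[p q] pq_in /=.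
  have kn : (0 + k <= n.+1)%N := leq_trans (leq_addl _ _) jkn.
  have [_ eK er ->] := crossing_step kn cs pq_in.
  have cs' : crossing n k j (up v) (map up s) by rewrite cross_up.
  have [|_ _ _ ->] := crossing_step (p := up p) (q := up q) jkn cs'.
    by rewrite -map_cons zip_up; apply/mapP; exists (p, q).
  rewrite /is_b edge_up ffunE /shift_edge /edge_ord /=.
  move: er; rewrite unfold_in /= => er.
  have e2 : ((edge_of p q).1.2 < k)%N by have := congr1 (fun e => e.1.2) eK => /= <-.
  by rewrite inordK ?modn_small//; lia.
congr inf; apply/seteqP; split => x /= [v [s [cs ->]]].
- have upK p : in_rect n k j p -> up (dn p) = p.
    by case: p => x' y' /and3P[/= _ yj _]; rewrite /up /dn /= subnK.
  case/and4P: (cs) => _ /allP rs _ _.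
  have sE : s = map up (map dn s).
    rewrite -map_comp -[LHS]map_id; apply/eq_in_map => p ps /=.
    by rewrite upK// rs// inE ps orbT.
  have vE : v = up (dn v) by rewrite upK// rs// mem_head.
  move: cs; rewrite vE sE cross_up => cs.
  by exists (dn v), (map dn s); split => //; rewrite -time_up -?sE -?vE.
- by exists (up v), (map up s); rewrite cross_up time_up.
Qed.

Section PositiveWeights.
Hypotheses (a0 : 0 < a) (ab : a < b).

Lemma path_time_ge0 i k v s w : (i + k <= n.+1)%N -> crossing n k i v s ->
  0 <= path_time (env a b w) v s.
Proof.
move=> ikn cs; rewrite /path_time big_seq; apply: sumr_ge0 => -[p q].
move=> /(crossing_step ikn cs)[_ _ _ -> /=].
by case: ifP => _; rewrite ltW// (lt_trans a0).
Qed.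

Lemma has_inf_crossing i k w : (0 < k)%N -> (i + k <= n.+1)%N ->
  has_inf [set x : R | exists v s, crossing n k i v s /\ x = path_time (env a b w) v s].
Proof.
move=> k0 ikn; split; last first.
  by exists 0 => x /= [v [s [cs ->]]]; exact: (path_time_ge0 w ikn cs).
(* The straight path along row [i] shows that crossings exist. *)
pose s := [seq (x.+1, i) | x <- iota 0 n].
exists (path_time (env a b w) (0%N, i) s), (0%N, i), s; split => //.
have path_s m x : path adj (x, i) [seq (y.+1, i) | y <- iota x m].
  by elim: m x => [|m IHm] x //=; rewrite IHm /adj /= eqxx.
have last_s m x : (last (x, i) [seq (y.+1, i) | y <- iota x m]).1 = (x + m)%N.
  by elim: m x => [|m IHm] x /=; rewrite ?addn0// IHm addSnnS.
rewrite /crossing path_s last_s !eqxx !andbT /=.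
apply/andP; split; first by rewrite /in_rect /=; lia.
by apply/allP => p /mapP[y]; rewrite mem_iota => yn ->; rewrite /in_rect /=; lia.
Qed.

(** Strip [j] of the bottom rectangle, between columns [j * k] and [j * k + k], is as wide as the
    rectangle is high, which makes it self-dual. *)
Definition blocked (k j : nat) w : bool := `[< is_blocked (is_b w) k (j * k) >].

(* A path whose passage time is less than the infimum plus [(b - a) / 2] has a
   [b]-edge in every blocked strip, and turning any [b]-edge of that path into an
   [a]-edge lowers the crossing time. *)
Lemma flip_set k w : (0 < k)%N -> (k <= n.+1)%N ->
  exists S : {set edge},
    [/\ {subset S <= rows 0 k}, forall e : edge, e \in S -> w e,
        (#|[pred j : 'I_(n %/ k) | blocked k j w]| <= #|S|)%N &
        forall w' (e0 : edge), (forall e : edge, w' e -> w e) -> e0 \in S -> ~~ w' e0 ->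
          t_cross (env a b w') n k 0 < t_cross (env a b w) n k 0].
Proof.
move=> k0 kn.
have kn' : (0 + k <= n.+1)%N by [].
(* An almost optimal path suffices: the slack is half of the gain [b - a] from one turned edge. *)
have ba : 0 < (b - a) / 2 by rewrite divr_gt0 ?subr_gt0.
have [_ /= [v [s [cs ->]]] lt_vs] := inf_adherent ba (has_inf_crossing w k0 kn').
pose step (pq : nat * nat * (nat * nat)) := edge_ord (edge_of pq.1 pq.2).
exists [set e in map step (zip (v :: s) s) | w e]; split.
- move=> e; rewrite inE => /andP[/mapP[[p q] pq_in ->] _].
  by have [] := crossing_step kn' cs pq_in.
- by move=> e; rewrite inE => /andP[].
- set S := [set _ in _ | _].
  (* The column of an edge determines its strip; the image of [S] under this map contains all
     blocked strips. *)
  pose strip (e : edge) : option 'I_(n %/ k) := insub (e.1.1 %/ k)%N.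
  rewrite -(card_imset _ (@Some_inj _)).
  apply: leq_trans (leq_imset_card strip S); apply: subset_leq_card.
  apply/fintype.subsetP => _ /imsetP[j jb ->]; move: jb; rewrite unfold_in.
  move=> /asboolP[h [h0 h1 hb]].
  have jk : (j * k + k <= n)%N.
    by have := leq_trunc_div n k; have := ltn_ord j; nia.
  have [|[p q] pq_in hpq] := @zip_change h v s.
    case/and4P: cs => _ _ /eqP v0 /eqP vn; rewrite h0 ?v0// h1// vn//.
  have [pq eK er _] := crossing_step kn' cs pq_in.
  case/and4P: (cs) => ps rs _ _.
  have [_ /and3P[_ _ pk] /and3P[_ _ qk]] := path_zip ps rs pq_in.
  apply/imsetP; exists (step (p, q)); last first.
    rewrite /strip; have -> : nat_of_ord (step (p, q)).1.1 = (edge_of p q).1.1.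
      by have := congr1 (fun e => e.1.1) eK.
    by rewrite (div_strip k0 (strip_edge h0 h1 pq hpq)) valK.
  rewrite inE; apply/andP; split; first by apply/mapP; exists (p, q).
  exact: hb.
- move=> w' e0 w'w; rewrite inE => /andP[/mapP[pq0 pq0_in ->] wb] w'a.
  apply: le_lt_trans (_ : path_time (env a b w') v s < _).
    apply: ge_inf; last by exists v, s.
    by have [] := has_inf_crossing w' k0 kn'.
  suff : path_time (env a b w') v s <= path_time (env a b w) v s - (b - a) by lra.
  pose cost (u : cfg n) pq : R := if u (step pq) then b else a.
  have timeE u : path_time (env a b u) v s = \sum_(pq <- zip (v :: s) s) cost u pq.
    rewrite /path_time big_seq [RHS]big_seq; apply: eq_bigr => -[p q].
    by move=> /(crossing_step kn' cs)[].
  (* One occurrence of the turned edge is singled out; the cost of every other step can only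
     decrease. *)
  rewrite !timeE (big_rem pq0)// [X in _ <= X - _](big_rem pq0)//=.
  rewrite {1 3}/cost wb (negbTE w'a).
  set A := \sum_(_ <- _) _; set B := \sum_(_ <- _) _.
  suff : A <= B by lra.
  apply: ler_sum => pq _; rewrite /cost; case: ifP => [/w'w ->//|_].
  by case: ifP => _ //; exact: ltW.
Qed.

End PositiveWeights.

(** * Independence and self-duality of the strips *)

Definition strip_edges k j : {pred edge} :=
  [pred e : edge | (e.1.1 %/ k == j)%N && (e.1.2 < k)%N].

Lemma blocked_depends k j : (0 < k)%N -> (j * k + k <= n)%N ->
  depends_on (strip_edges k j) (blocked k j).
Proof.
move=> k0 jk w w' ww'; apply/asboolP/asboolP => -[h [h0 h1 hb]];
  exists h; split => // p q pq pk qk hpq; have := hb p q pq pk qk hpq;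
  rewrite /is_b ww'// unfold_in /=.
all: have /andP[e1 e2] := strip_edge h0 h1 pq hpq.
all: have ek : ((edge_of p q).1.2 < k)%N by have [->|->] := edge_of_coord p q.
all: rewrite !inordK ?ek ?andbT; try lia.
all: by rewrite (div_strip k0 (strip_edge h0 h1 pq hpq)).
Qed.

(* The edge whose dual corresponds to [e] under the reflection exchanging the
   two coordinates of the strip. *)
Definition dual_nat k x0 (e : nat * nat * bool) : nat * nat * bool :=
  let: (x, y, d) := e in
  if d then
    if [&& x0 < x, x < x0 + k & y.+1 < k]%N then (x0 + y.+1, (x - x0).-1, true)%N else e
  else if [&& x0 <= x, x < x0 + k & y < k]%N then (x0 + y, x - x0, false)%N else e.

Lemma dual_natK k x0 : involutive (dual_nat k x0).
Proof.
move=> [[x y] []] /=; case: ifP => cond /=; rewrite ?cond//;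
  (rewrite ifT; last lia); congr (_, _, _); lia.
Qed.

Lemma dual_nat_le k x0 e : (x0 + k <= n)%N -> (e.1.1 <= n)%N -> (e.1.2 <= n)%N ->
  ((dual_nat k x0 e).1.1 <= n)%N /\ ((dual_nat k x0 e).1.2 <= n)%N.
Proof.
by case: e => [[x y] []] /= xk xn yn; case: ifP => /=; lia.
Qed.

Definition dual_cfg k x0 w : cfg n :=
  [ffun e => ~~ w (edge_ord (dual_nat k x0 (edge_nat e)))].

Lemma dual_cfgE k x0 w e : (x0 + k <= n)%N -> (e.1.1 <= n)%N -> (e.1.2 <= n)%N ->
  is_b (dual_cfg k x0 w) e = ~~ is_b w (dual_nat k x0 e).
Proof. by move=> xk e1 e2; rewrite /is_b ffunE edge_ordK. Qed.

Lemma dual_cfgK k x0 : (x0 + k <= n)%N -> involutive (dual_cfg k x0).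
Proof.
move=> xk w; apply/ffunP => e; rewrite ffunE.
set f := edge_nat e.
have [f1 f2] : (f.1.1 <= n)%N /\ (f.1.2 <= n)%N.
  by split; rewrite -ltnS; exact: ltn_ord.
have [g1 g2] := dual_nat_le xk f1 f2.
have := dual_cfgE w xk g1 g2; rewrite /is_b dual_natK => ->.
by rewrite negbK edge_natK.
Qed.

(** If the dual configuration is not blocked, it has an open path across the strip, and the dual of
    that path blocks [w]. *)
Lemma blocked_dual k j w : (0 < k)%N -> (j * k + k <= n)%N ->
  blocked k j w || blocked k j (dual_cfg k (j * k) w).
Proof.
move=> k0 jk; rewrite orbC; apply/orP.
have [|nb] := boolP (blocked k j _); [by left|right].
apply/asboolP.
have /(blocked_or_open_path k0)[v [s [v0 ps lk lx]]] :
  ~ is_blocked (is_b (dual_cfg k (j * k) w)) k (j * k) by move/asboolP: nb.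
apply: open_path_blocked v0 ps lk lx => x y xk yk.
- rewrite dual_cfgE ?negbK /=; try lia.
  rewrite ifT; last lia.
  by rewrite (_ : j * k + y - j * k = y)%N//; lia.
- rewrite dual_cfgE ?negbK /=; try lia.
  rewrite ifT; last lia.
  by rewrite (_ : (j * k + y.+1 - j * k).-1 = y)%N//; lia.
Qed.

(** The duality is an involution, hence preserves the uniform law; so two events of equal
    probability cover the whole space. *)
Lemma prob_blocked k j : (0 < k)%N -> (j * k + k <= n)%N ->
  2^-1 <= prob (blocked k j) :> R.
Proof.
move=> k0 jk; rewrite /prob unif_EE.
have dualE : \sum_w (blocked k j w)%:R =
    \sum_w (blocked k j (dual_cfg k (j * k) w))%:R :> R.
  by rewrite (reindex_inj (inv_inj (dual_cfgK jk))).
have : (\sum_(w : cfg n) 1 : R) <=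
    \sum_w (blocked k j w)%:R + \sum_w (blocked k j (dual_cfg k (j * k) w))%:R.
  rewrite -big_split/=; apply: ler_sum => w _.
  have := blocked_dual w k0 jk.
  by case: (blocked k j w) => /= [_|->]; rewrite ?lerDl ?add0r.
rewrite -dualE sumr_const card_ffun card_bool natrX => le2.
rewrite exprVn ler_pdivlMl ?exprn_gt0//; lra.
Qed.

End Configurations.

(** * Random flips *)

Section Flips.
Variables (R : realType) (E : finType) (D : {pred E}) (delta : R).
Hypothesis delta01 : 0 <= delta <= 1.
Local Notation cfgE := {ffun E -> bool}.

(* Joint law of a uniform bit and of its image when every [true] in [D] is turned
   into [false] with probability [delta], conditionally on the bit. *)
Definition flip_law (e : E) (x y : bool) : R :=
  if e \in D then (if x then (if y then 1 - delta else delta) else (~~ y)%:R)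
  else (x == y)%:R.

Definition flip_kernel (w w' : cfgE) : R := \prod_e flip_law e (w e) (w' e).

(** Density, with respect to the uniform law, of the image of a uniform configuration under the
    flips. *)
Definition flip_density (w : cfgE) : R :=
  \prod_e (if e \in D then (if w e then 1 - delta else 1 + delta) else 1).

Lemma flip_law_ge0 e x y : 0 <= flip_law e x y.
Proof.
case/andP: delta01 => d0 d1.
by rewrite /flip_law; case: ifP; case: x; case: y => //= _; rewrite subr_ge0.
Qed.

Lemma flip_kernel_ge0 w w' : 0 <= flip_kernel w w'.
Proof. by apply: prodr_ge0 => e _; exact: flip_law_ge0. Qed.

Lemma flip_kernel_sum1 w : \sum_w' flip_kernel w w' = 1.
Proof.
rewrite -(bigA_distr_bigA (fun e y => flip_law e (w e) y)) big1// => e _.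
by rewrite big_bool /= /flip_law; case: ifP; case: (w e) => /= _; ring.
Qed.

Lemma flip_kernel_density w' : \sum_w flip_kernel w w' = flip_density w'.
Proof.
rewrite -(bigA_distr_bigA (fun e x => flip_law e x (w' e))); apply: eq_bigr => e _.
by rewrite big_bool /= /flip_law; case: ifP; case: (w' e) => /= _; ring.
Qed.

Lemma flip_kernel_le w w' : flip_kernel w w' != 0 -> forall e, w' e -> w e.
Proof.
move=> K0 e w'e; apply: contraNT K0 => we; rewrite /flip_kernel (bigD1 e)//=.
by rewrite /flip_law (negbTE we) w'e /= if_same mul0r.
Qed.

Lemma flip_kernel_noflip (w : cfgE) (S : {set E}) : {subset S <= D} -> {in S, forall e, w e} ->
  \sum_(w' : cfgE) flip_kernel w w' * [forall (e | e \in S), w' e]%:R = (1 - delta) ^+ #|S|.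
Proof.
move=> SD Sw.
transitivity (\sum_(w' : cfgE) \prod_e (flip_law e (w e) (w' e) * ((e \in S) ==> w' e)%:R)).
  apply: eq_bigr => w' _; rewrite big_split/=; congr (_ * _).
  case: forallP => [Sw'|Sw']; first by rewrite big1// => e _; rewrite Sw'.
  have /existsP[e eS] : [exists e, ~~ ((e \in S) ==> w' e)].
    by rewrite -negb_forall; apply/forallP.
  by rewrite (bigD1 e)//= (negbTE eS) mul0r.
rewrite -(bigA_distr_bigA (fun e y => flip_law e (w e) y * ((e \in S) ==> y)%:R)).
rewrite (bigID (fun e => e \in S))/= [X in _ * X]big1 ?mulr1 => [|e eS].
  rewrite -prodr_const; apply: eq_bigr => e eS.
  by rewrite big_bool /= eS /flip_law SD// Sw//= mulr1 mulr0 addr0.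
rewrite big_bool/= (negbTE eS) /= !mulr1 /flip_law.
by case: ifP; case: (w e) => /= _; ring.
Qed.

Lemma pow_density_bound (N : nat) : N%:R * delta <= 1 ->
  (1 + delta) ^+ N + (1 - delta) ^+ N <= 2 * (1 + N%:R ^+ 2 * delta ^+ 2).
Proof.
case/andP: delta01 => d0 d1 Nd.
(* The two powers are bounded separately, with linear terms that cancel in the sum; only the second
   order in [delta] survives. *)
suff [h1 h2] : (1 + delta) ^+ N <= 1 + N%:R * delta + N%:R ^+ 2 * delta ^+ 2 /\
    (1 - delta) ^+ N <= 1 - N%:R * delta + N%:R ^+ 2 * delta ^+ 2 by lra.
elim: N Nd => [|N IHN]; first by rewrite !expr0; split; lra.
rewrite -natr1 => Nd; have N0 : 0 <= N%:R :> R by [].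
have [|h1 h2] := IHN; first by nra.
have dd : 0 <= delta ^+ 2 by exact: sqr_ge0.
split; rewrite exprS.
- apply: le_trans (ler_wpM2l _ h1) _; first lra.
  have : N%:R * delta * (N%:R * delta ^+ 2) <= 1 * (N%:R * delta ^+ 2).
    by rewrite ler_wpM2r ?mulr_ge0//; lra.
  nra.
- apply: le_trans (ler_wpM2l _ h2) _; first lra.
  have : 0 <= N%:R ^+ 2 * delta ^+ 2 * delta by rewrite !mulr_ge0 ?exprn_ge0.
  have : 0 <= N%:R * delta ^+ 2 by rewrite mulr_ge0.
  nra.
Qed.

Lemma EE_density_pow (N : nat) : N%:R * delta <= 1 ->
  EE (@unif R E) (fun w => flip_density w ^+ N) <= (1 + N%:R ^+ 2 * delta ^+ 2) ^+ #|D|.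
Proof.
move=> Nd; case/andP: delta01 => d0 d1.
pose g (e : E) (v : bool) : R :=
  (if e \in D then (if v then 1 - delta else 1 + delta) else 1) ^+ N.
rewrite (_ : EE _ _ = EE (@unif R E) (fun w => \prod_e g e (w e))); last first.
  by apply: EE_eq => w; rewrite /flip_density -prodrXl.
rewrite EE_prod -prodr_const [leRHS]big_mkcond/=; apply: ler_prod => e _.
rewrite big_bool/= /unif /g; case: ifP => _; last by rewrite expr1n; apply/andP; split; lra.
have h1 : 0 <= (1 - delta) ^+ N by apply: exprn_ge0; lra.
have h2 : 0 <= (1 + delta) ^+ N by apply: exprn_ge0; lra.
by have h3 := pow_density_bound Nd; apply/andP; split; lra.
Qed.

(** Start from [F] and flip: either no edge of [S] is turned, which has probability at most
    [(1 - delta) ^+ c w], or the image lies in [G]. The law of the image is then compared with the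
    uniform one. *)
Lemma flip_comparison (F G : pred cfgE) (c : cfgE -> nat) (kappa : R) (N : nat) :
  0 < kappa -> N.+1%:R * delta <= 1 ->
  (forall w, F w -> exists S : {set E},
     [/\ {subset S <= D}, forall e : E, e \in S -> w e, (c w <= #|S|)%N &
       forall (w' : cfgE) e0, (forall e : E, w' e -> w e) -> e0 \in S -> ~~ w' e0 -> G w']) ->
  prob F <= (1 + kappa) * prob G
    + (1 + N.+1%:R ^+ 2 * delta ^+ 2) ^+ #|D| / (1 + kappa) ^+ N
    + EE (@unif R E) (fun w => (1 - delta) ^+ c w).
Proof.
move=> k0 Nd HS; case/andP: (delta01) => d0 d1.
have d01 : 0 <= 1 - delta <= 1 by lra.
have step1 w : (F w)%:R <= \sum_w' flip_kernel w w' * (G w')%:R + (1 - delta) ^+ c w.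
  have rhs0 : 0 <= \sum_w' flip_kernel w w' * (G w')%:R.
    by apply: sumr_ge0 => w' _; rewrite mulr_ge0 ?flip_kernel_ge0.
  case: (boolP (F w)) => [/HS[S [SD Sw cS SG]]|_]; last first.
    by rewrite addr_ge0// exprn_ge0//; lra.
  apply: le_trans (_ : _ <= \sum_w' flip_kernel w w' * (G w')%:R + (1 - delta) ^+ #|S|) _;
    last by rewrite lerD2l ler_wiXn2l//; lra.
  rewrite -(flip_kernel_noflip SD Sw) -[true%:R]/1 -[leLHS](flip_kernel_sum1 w).
  rewrite -big_split/=.
  apply: ler_sum => w' _; rewrite -mulrDr.
  have [->|K0] := eqVneq (flip_kernel w w') 0; first by rewrite mul0r.
  rewrite ler_peMr ?flip_kernel_ge0//.
  case: forallP => [_|nf]; first by apply: ler_wpDl; rewrite ?ler0n.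
  have /existsP[e] : [exists e, ~~ ((e \in S) ==> w' e)].
    by rewrite -negb_forall; apply/forallP.
  rewrite negb_imply => /andP[eS w'e].
  have -> : G w' by apply: SG eS w'e; exact: flip_kernel_le K0.
  by apply: ler_wpDr; rewrite ?ler0n.
apply: le_trans (EE_le (@unif_ge0 R E) step1) _; rewrite EED lerD2r.
have -> : EE (@unif R E) (fun w => \sum_w' flip_kernel w w' * (G w')%:R) =
    EE (@unif R E) (fun w => flip_density w * (G w)%:R).
  rewrite !unif_EE exchange_big/=; congr (_ * _); apply: eq_bigr => w _.
  by rewrite -big_distrl/= flip_kernel_density.
have density0 w : 0 <= flip_density w.
  by rewrite -flip_kernel_density sumr_ge0// => w' _; exact: flip_kernel_ge0.
have k1 : 0 < 1 + kappa by lra.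
(* Markov truncation: where the density exceeds [1 + kappa], it is dominated by its power [N.+1]
   divided by [(1 + kappa) ^+ N]. *)
have step2 w : flip_density w * (G w)%:R <=
    (1 + kappa) * (G w)%:R + ((1 + kappa) ^+ N)^-1 * flip_density w ^+ N.+1.
  have t0 : 0 <= ((1 + kappa) ^+ N)^-1 * flip_density w ^+ N.+1.
    by rewrite mulr_ge0 ?invr_ge0 ?exprn_ge0//; lra.
  case: (G w); rewrite ?mulr0 ?mulr1 ?add0r//.
  have [le|lt] := leP (flip_density w) (1 + kappa); first lra.
  rewrite ler_wpDl ?(ltW k1)// mulrC ler_pdivlMr ?exprn_gt0// exprS.
  by rewrite ler_wpM2l// lerXn2r ?nnegrE// ltW.
apply: le_trans (EE_le (@unif_ge0 R E) step2) _.
rewrite EED !EEZ lerD2l mulrC ler_wpM2r ?invr_ge0 ?exprn_ge0 ?(ltW k1)//.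
exact: EE_density_pow.
Qed.

End Flips.

(** * Comparing crossing times at most [q] with crossing times below [q] *)

Lemma card_rows n k : (k <= n)%N -> (#|@rows n 0 k| <= n.+1 * k * 2)%N.
Proof.
move=> kn.
pose f (u : 'I_n.+1 * 'I_k * bool) := (u.1.1, widen_ord (leqW kn) u.1.2, u.2).
have <- : #|{: 'I_n.+1 * 'I_k * bool}| = (n.+1 * k * 2)%N.
  by rewrite !card_prod !card_ord card_bool.
apply: leq_trans (leq_image_card f _); apply: subset_leq_card.
apply/fintype.subsetP => -[[x y] d]; rewrite unfold_in /= => yk.
by apply/fintype.imageP; exists (x, Ordinal yk, d) => //; congr (_, _, _); apply/val_inj.
Qed.

Lemma crossing_comparison (R : realType) (a b q delta kappa : R) (n k N : nat) :
  0 < a -> a < b -> (0 < k)%N -> (k <= n)%N -> 0 <= delta <= 1 -> 0 < kappa ->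
  N.+1%:R * delta <= 1 ->
  prob (fun w : cfg n => t_cross (env a b w) n k 0 <= q) <=
  (1 + kappa) * prob (fun w : cfg n => t_cross (env a b w) n k 0 < q)
  + (1 + N.+1%:R ^+ 2 * delta ^+ 2) ^+ (n.+1 * k * 2) / (1 + kappa) ^+ N
  + (1 - delta / 2) ^+ (n %/ k).
Proof.
move=> a0 ab k0 kn d01 kp Nd.
case/andP: (d01) => d0 d1.
pose c (w : cfg n) := #|[pred j : 'I_(n %/ k) | blocked k j w]|.
have jk (j : 'I_(n %/ k)) : (j * k + k <= n)%N.
  by have := leq_trunc_div n k; have := ltn_ord j; nia.
pose F (w : cfg n) := t_cross (env a b w) n k 0 <= q.
pose G (w : cfg n) := t_cross (env a b w) n k 0 < q.
have FG (w : cfg n) : F w -> exists S : {set 'I_n.+1 * 'I_n.+1 * bool},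
    [/\ {subset S <= rows 0 k}, forall e, e \in S -> w e, (c w <= #|S|)%N &
      forall (w' : cfg n) e0, (forall e, w' e -> w e) -> e0 \in S -> ~~ w' e0 -> G w'].
  move=> wq; have [S [SD Sw cS St]] := flip_set a0 ab w k0 (leqW kn).
  exists S; split => // w' e0 w'w e0S w'e0.
  exact: lt_le_trans (St _ _ w'w e0S w'e0) wq.
apply: le_trans (flip_comparison d01 kp Nd FG) _.
have k1 : 0 < 1 + kappa by lra.
apply: lerD; [rewrite lerD2l|].
  rewrite ler_wpM2r ?invr_ge0 ?exprn_ge0 ?(ltW k1)//.
  rewrite ler_weXn2l//; first by rewrite lerDl mulr_ge0 ?sqr_ge0.
  exact: card_rows.
(* Distinct strips share no edge and each is blocked with probability at least one half, so the mean
   factorizes and each factor is at most [1 - delta / 2]. *)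
have -> : EE (@unif R _) (fun w => (1 - delta) ^+ c w) =
    EE (@unif R _) (fun w : cfg n => \prod_(j < n %/ k) (1 - delta * (blocked k j w)%:R)).
  apply: EE_eq => w; rewrite /c -prodr_const big_mkcond/=; apply: eq_bigr => j _.
  by rewrite unfold_in; case: ifP => _; rewrite ?mulr1 ?mulr0 ?subr0.
rewrite (EE_indep_prod (@unif_sum1 R _) (D := fun j : 'I_(n %/ k) => @strip_edges n k j));
  last 2 first.
- by move=> i j e; rewrite !unfold_in => /andP[/eqP ei _] /andP[/eqP ej _];
  apply/val_inj; rewrite /= -ei -ej.
- by move=> j w w' ww'; rewrite (blocked_depends k0 (jk j) ww').
rewrite -[X in _ ^+ X]card_ord -prodr_const; apply: ler_prod => j _.
have EE1 : EE (@unif R _) (fun _ : cfg n => 1) = 1 := EE_cst (@unif_sum1 R _) 1.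
have -> : EE (@unif R _) (fun w : cfg n => 1 - delta * (blocked k j w)%:R) =
    1 - delta * prob (@blocked n k j).
  transitivity (EE (@unif R _) (fun _ : cfg n => 1) +
    EE (@unif R _) (fun w : cfg n => - delta * (blocked k j w)%:R)).
    by rewrite -EED; apply: EE_eq => w; rewrite mulNr.
  by rewrite EE1 EEZ mulNr.
have p1 : prob (@blocked n k j) <= 1 :> R.
  rewrite -[leRHS]EE1.
  by apply: EE_le => [|w]; [exact: unif_ge0|rewrite lern1 leq_b1].
have p2 := prob_blocked R k0 (jk j).
have : delta * prob (@blocked n k j) <= delta * 1 by rewrite ler_wpM2l.
have : delta * 2^-1 <= delta * prob (@blocked n k j) by rewrite ler_wpM2l.
by move=> *; apply/andP; split; lra.
Qed.

(** * Minimum over rectangles *)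

Section Minimum.
Variables (R : realType) (a b q : R) (n k : nat).
Hypotheses (k0 : (0 < k)%N) (kn : (k <= n)%N).
Local Notation edge := ('I_n.+1 * 'I_n.+1 * bool)%type.
Local Notation m := (n %/ k)%N.
Implicit Types w : cfg n.

Lemma strip_fits (j : 'I_m) : (j * k + k <= n)%N.
Proof. by have := leq_trunc_div n k; have := ltn_ord j; nia. Qed.

(** Since [k <= n] there is at least one rectangle, so the infimum is a true minimum and not a
    default value. Rectangles are renumbered from 0. *)
Lemma tau_star_min w : exists j0 : 'I_m,
  tau_star (env a b w) n k = t_cross (env a b w) n k (j0 * k) /\
  forall j : 'I_m, t_cross (env a b w) n k (j0 * k) <= t_cross (env a b w) n k (j * k).
Proof.
have m0 : (0 < m)%N by rewrite divn_gt0.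
pose T (j : 'I_m) := t_cross (env a b w) n k (j * k).
have [j0 _ j0_min] := Order.TotalTheory.arg_minP T (isT : xpredT (Ordinal m0)).
exists j0; split; last by move=> j; exact: j0_min.
have lbT : lbound [set x : R | exists2 i : nat, (0 < i <= m)%N &
    x = t_cross (env a b w) n k ((i - 1) * k)] (T j0).
  move=> x /= [i /andP[i0 im] ->].
  have im' : (i - 1 < m)%N by lia.
  exact: (j0_min (Ordinal im') isT).
have Tj0 : [set x : R | exists2 i : nat, (0 < i <= m)%N &
    x = t_cross (env a b w) n k ((i - 1) * k)] (T j0).
  by exists j0.+1; rewrite ?ltn_ord// subn1.
apply/le_anti/andP; split; first by apply: ge_inf => //; exists (T j0).
by apply: lb_le_inf => //; exists (T j0).
Qed.

Lemma tau_gtE w :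
  (q < tau_star (env a b w) n k)%R%:R =
  \prod_(j < m) (1 - (t_cross (env a b w) n k (j * k) <= q)%R%:R) :> R.
Proof.
have [j0 [-> j0_min]] := tau_star_min w.
have [lt|ge] := ltP q; last by rewrite (bigD1 j0)//= ge subrr mul0r.
by rewrite big1// => j _; rewrite leNgt (lt_le_trans lt (j0_min j)) subr0.
Qed.

Lemma tau_geE w :
  (q <= tau_star (env a b w) n k)%R%:R =
  \prod_(j < m) (1 - (t_cross (env a b w) n k (j * k) < q)%R%:R) :> R.
Proof.
have [j0 [-> j0_min]] := tau_star_min w.
have [le|gt] := leP q; last by rewrite (bigD1 j0)//= gt subrr mul0r.
by rewrite big1// => j _; rewrite ltNge (le_trans le (j0_min j)) subr0.
Qed.

Lemma rows_disjoint (i j : 'I_m) (e : edge) :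
  e \in rows (i * k) k -> e \in rows (j * k) k -> i = j.
Proof.
rewrite !unfold_in => /div_strip ei /div_strip ej.
by apply/val_inj; rewrite /= -(ei k0) -(ej k0).
Qed.

Lemma prob_shift (A : pred R) (j : 'I_m) :
  prob (fun w => A (t_cross (env a b w) n k (j * k))) =
  prob (fun w => A (t_cross (env a b w) n k 0)) :> R.
Proof.
rewrite /prob -[RHS](EE_perm _ (@shift_edge_inj n (j * k)))//.
by apply: EE_eq => w; rewrite (t_cross_shift a b w (leqW (strip_fits j))).
Qed.

Lemma corr_shift eps (A : pred R) (j : 'I_m) :
  corr eps (fun w => (A (t_cross (env a b w) n k (j * k)))%:R)
           (fun w => (A (t_cross (env a b w) n k (j * k)))%:R) =
  corr eps (fun w => (A (t_cross (env a b w) n k 0))%:R)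
           (fun w => (A (t_cross (env a b w) n k 0))%:R) :> R.
Proof.
rewrite /corr -[RHS](EE_perm _ (@shift_edge_inj n (j * k)))//.
apply: EE_eq => z.
have fits : (j * k + k <= n.+1)%N := leqW (strip_fits j).
rewrite (t_cross_shift a b (map_cfg fst z) fits) (t_cross_shift a b (map_cfg snd z) fits).
have mapE (f : bool * bool -> bool) :
    map_cfg f [ffun e => z (shift_edge (j * k) e)] = shift_rows (j * k) (map_cfg f z).
  by apply/ffunP => e; rewrite !ffunE.
by rewrite -!mapE.
Qed.

Lemma prob_prod (A : pred R) :
  EE (@unif R _) (fun w => \prod_(j < m) (1 - (A (t_cross (env a b w) n k (j * k)))%:R)) =
  (1 - prob (fun w => A (t_cross (env a b w) n k 0))) ^+ m.
Proof.
rewrite (EE_indep_prod (@unif_sum1 R _) (D := fun j : 'I_m => @rows n (j * k) k));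
  last 2 first.
- exact: rows_disjoint.
- by move=> j w w' ww'; rewrite (t_cross_depends a b (leqW (strip_fits j)) ww').
rewrite -[X in _ ^+ X]card_ord -prodr_const; apply: eq_bigr => j _.
rewrite -(prob_shift A j).
rewrite -[X in _ = X - _](EE_cst (@unif_sum1 R edge) 1) -mulN1r -EEZ -EED.
by apply: EE_eq => w; rewrite mulN1r.
Qed.

(** Noise acts edge by edge, so the noisy pairs seen by different rectangles stay independent;
    [corrN] evaluates one factor. *)
Lemma corr_prod eps (A : pred R) :
  let f w := \prod_(j < m) (1 - (A (t_cross (env a b w) n k (j * k)))%:R) : R in
  let g w := (A (t_cross (env a b w) n k 0))%:R : R in
  corr eps f f = (1 - 2 * EE (@unif R edge) g + corr eps g g) ^+ m.
Proof.
move=> f g; pose gj (j : 'I_m) w : R := (A (t_cross (env a b w) n k (j * k)))%:R.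
transitivity (EE (@noise_law R eps edge) (fun z => \prod_(j < m)
    ((1 - gj j (map_cfg fst z)) * (1 - gj j (map_cfg snd z))))).
  by apply: EE_eq => z; rewrite big_split.
rewrite (EE_indep_prod (@noise_law_sum1 R edge eps) (D := fun j : 'I_m => @rows n (j * k) k));
  last 2 first.
- exact: rows_disjoint.
- move=> j z z' zz'; rewrite /gj.
  have mapE (h : bool * bool -> bool) : {in rows (j * k) k, map_cfg h z =1 map_cfg h z'}.
    by move=> e er; rewrite !ffunE zz'.
  by rewrite !(t_cross_depends a b (leqW (strip_fits j)) (mapE _)).
rewrite -[X in _ ^+ X]card_ord -prodr_const; apply: eq_bigr => j _.
etransitivity; first exact: (corrN eps (fun w => A (t_cross (env a b w) n k (j * k)))).
congr (1 - 2 * _ + _); first exact: (prob_shift A j).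
exact: (corr_shift _ A j).
Qed.

End Minimum.

(** * Translation of [Pr], [Exp] and [noise_corr] into product expectations *)

Section PrExp.
Variables (R : realType) (n : nat).

Lemma Exp_EE (f : cfg n -> R) : Exp f = EE (@unif R _) f.
Proof.
by rewrite /Exp unif_EE card_ffun card_bool natrX mulrC exprVn.
Qed.

Lemma Pr_prob (A : pred (cfg n)) : Pr A = prob A :> R.
Proof. exact: Exp_EE. Qed.

Lemma noise_corrE eps (f : cfg n -> R) : noise_corr eps f = corr eps f f.
Proof. by rewrite corrE. Qed.

End PrExp.

(** * Elementary inequalities *)

Section RealBounds.
Variable R : realType.

Lemma subr_pow_le (x y : R) m : 0 <= x <= 1 -> 0 <= y <= 1 ->
  `|x ^+ m - y ^+ m| <= m%:R * `|x - y|.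
Proof.
move=> /andP[x0 x1] /andP[y0 y1]; rewrite subrXX normrM mulrC ler_wpM2r//.
apply: le_trans (ler_norm_sum _ _ _) _.
rewrite -[X in X%:R]card_ord -sumr_const; apply: ler_sum => i _.
by rewrite normrM !ger0_norm ?exprn_ge0// mulr_ile1 ?exprn_ge0 ?exprn_ile1.
Qed.

Lemma bernoulli (x : R) m : 0 <= x -> 1 + m%:R * x <= (1 + x) ^+ m.
Proof.
move=> x0; elim: m => [|m IHm]; first by rewrite mul0r addr0 expr0.
rewrite exprS; apply: le_trans (ler_wpM2l _ IHm); last lra.
have : 0 <= m%:R * x ^+ 2 by rewrite mulr_ge0 ?exprn_ge0.
rewrite -natr1; nra.
Qed.

Lemma pow_1sub_le (x : R) m : 0 <= x <= 1 -> (1 - x) ^+ m * (1 + x) ^+ m <= 1.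
Proof.
move=> /andP[x0 x1]; rewrite -exprMn.
have ? : (1 - x) * (1 + x) = 1 - x ^+ 2 by ring.
have ? := sqr_ge0 x.
by apply: exprn_ile1; [apply: mulr_ge0; lra|lra].
Qed.

Lemma nat_root8 n : exists r, (r ^ 8 <= n < r.+1 ^ 8)%N.
Proof.
elim: n => [|n [r /andP[rn nr]]]; first by exists 0%N.
have [e|ne] := eqVneq n.+1 (r.+1 ^ 8)%N.
  by exists r.+1; apply/andP; split; rewrite e// ltn_exp2r.
by exists r; rewrite leqW//= ltn_neqAle ne nr.
Qed.

End RealBounds.

(** * Tail comparison *)

Lemma succ_pow8_le r : (0 < r)%N -> (r.+1 ^ 8 <= 256 * r ^ 8)%N.
Proof.
move=> r0; have -> : (256 * r ^ 8 = (2 * r) ^ 8)%N by rewrite expnMn.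
by rewrite leq_exp2r//; lia.
Qed.

(** With [delta = r ^- 6] and moment [r.+1], this bounds the exponent in the density moment by the
    constant [2048 = 4 * 256 * 2]. *)
Lemma flip_count_bound n k r : (0 < r)%N -> (k <= r)%N -> (n < r.+1 ^ 8)%N ->
  (r.+1 ^ 2 * (n.+1 * k * 2) <= 2048 * r ^ 12)%N.
Proof.
move=> r0 kr nr.
have n_le : (n.+1 <= 256 * r ^ 8)%N := leq_trans nr (succ_pow8_le r0).
have s_le : (r.+1 ^ 2 <= 4 * r ^ 2)%N by rewrite -(expnMn 2 r 2) leq_exp2r//; lia.
apply: leq_trans (leq_mul s_le (leq_mul (leq_mul n_le kr) (leqnn 2))) _.
have -> : (r ^ 12 = r ^ 2 * r ^ 8 * r * r)%N by rewrite -expnD -!expnSr.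
have := leq_pmulr (r ^ 2 * r ^ 8 * r) r0.
by move: (r ^ 2)%N (r ^ 8)%N => u v; lia.
Qed.

Lemma succ_le_pow6 r : (2 <= r)%N -> (r.+1 <= r ^ 6)%N.
Proof.
move=> r2; apply: leq_trans (_ : r ^ 2 <= _)%N; last by rewrite leq_pexp2l//; lia.
by rewrite expnS expn1; nia.
Qed.

(** The constant 49 leaves room. For [h <= 100^-1] the right side is below 3/2, the growth available
    from each group of [r ^ 6] strips. *)
Lemma pow9_le (R : realType) (h : R) : 0 < h -> h <= 100^-1 ->
  (1 + h) ^+ 9 <= 1 + 49 * h.
Proof.
move=> h0 h1.
have h2 : h ^+ 2 <= h / 100 by rewrite expr2; apply: ler_wpM2l; first exact: ltW.
have h3 : h ^+ 3 <= h / 100.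
  by rewrite exprS; apply: ler_wpM2l; [exact: ltW|lra].
have -> : (1 + h) ^+ 9 = ((1 + h) ^+ 3) ^+ 3 by ring.
apply: le_trans (_ : (1 + 7 * h) ^+ 3 <= _).
  by apply: lerXn2r; rewrite ?nnegrE; [apply: exprn_ge0; lra|lra|nra].
nra.
Qed.

Lemma tail_arith (R : realType) (p p' u v e s t c : R) :
  p <= t * p' + u + v -> t <= 1 + c -> 0 <= p' -> u <= e * s -> v <= s ->
  p - p' <= c * p' + (e + 1) * s.
Proof.
move=> hp tc p'0 us vs; have := ler_wpM2r p'0 tc; rewrite !mulrDl !mul1r; lra.
Qed.

(** Here [x] stands for [r] and [m] for the number of rectangles: the ninth power exceeds the eighth
    by one, which leaves a factor [1 / x]. *)
Lemma tail_error (R : realType) (m x h g c : R) : 0 <= m -> 0 < x -> 0 < h -> 0 <= c ->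
  m <= 256 * x ^+ 8 -> (x * h) ^+ 9 <= g -> m * (c / g) <= 256 * c / h ^+ 9 / x.
Proof.
move=> m0 x0 h0 c0 mx gx.
have xh : 0 < (x * h) ^+ 9 by rewrite exprn_gt0 ?mulr_gt0.
have g0 : 0 < g := lt_le_trans xh gx.
apply: le_trans (_ : 256 * x ^+ 8 * (c / (x * h) ^+ 9) <= _).
  apply: ler_pM => //; first by rewrite divr_ge0// ltW.
  by rewrite ler_wpM2l// lef_pV2.
rewrite le_eqVlt; apply/orP; left; apply/eqP; field.
by rewrite !gt_eqF.
Qed.

(* With [n] of order [r ^ 8], the flip probability is [r ^- 6] and the density is
   cut at [(1 + h) ^+ 9], so that the error [(1 + h) ^- (9 * r)] beats the number
   of rectangles, which is at most of order [r ^ 8]. *)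
Lemma tail_comparison (R : realType) (a b q h : R) (n k r : nat) :
  0 < a -> a < b -> (0 < k <= r)%N -> (2 <= r)%N -> (r ^ 8 <= n < r.+1 ^ 8)%N ->
  0 < h <= 100^-1 ->
  (n %/ k)%:R * (prob (fun w : cfg n => t_cross (env a b w) n k 0 <= q) -
                 prob (fun w : cfg n => t_cross (env a b w) n k 0 < q)) <=
  49 * h * ((n %/ k)%:R * prob (fun w : cfg n => t_cross (env a b w) n k 0 < q))
    + 256 * (expR 2048 + 1) / h ^+ 9 / r%:R.
Proof.
move=> a0 ab /andP[k0 kr] r2 /andP[rn nr] /andP[h0 h1].
set p := prob _; set p' := prob _.
have r0 : (0 < r)%N by lia.
have r_le_r8 : (r <= r ^ 8)%N by rewrite -[X in (X <= _)%N]expn1 leq_pexp2l.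
have kn : (k <= n)%N by lia.
set x : R := r%:R; set m := (n %/ k)%N.
have x0 : 0 < x by rewrite ltr0n.
have x1 : 1 <= x by rewrite ler1n.
have H9 := pow9_le h0 h1.
have hp9 : 1 <= (1 + h) ^+ 9 by apply: exprn_ege1; lra.
pose delta : R := (x ^+ 6)^-1.
have x6 : 1 <= x ^+ 6 by apply: exprn_ege1.
have d01 : 0 <= delta <= 1.
  by rewrite invr_ge0 (le_trans ler01 x6) /= invf_le1// (lt_le_trans ltr01 x6).
(* [kappa = (1 + h) ^+ 9 - 1] and [N = r] are used, so that the truncation factor is
   [(1 + h) ^+ (9 * r)]. *)
have kap0 : 0 < (1 + h) ^+ 9 - 1.
  by rewrite subr_gt0; apply: exprn_egt1 => //; lra.
have rd : r.+1%:R * delta <= 1.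
  rewrite ler_pdivrMr ?(lt_le_trans ltr01 x6)// mul1r /x -natrX ler_nat.
  exact: succ_le_pow6.
have := crossing_comparison q a0 ab k0 kn d01 kap0 rd.
rewrite -/p -/p' [1 + (_ - 1)]addrC subrK -exprM.
set D := (n.+1 * k * 2)%N.
set y := 1 + r.+1%:R ^+ 2 * delta ^+ 2.
have yD : y ^+ D <= expR 2048.
  apply: le_trans (_ : expR (r.+1%:R ^+ 2 * delta ^+ 2) ^+ D <= _).
    apply: lerXn2r; rewrite ?nnegrE ?expR_ge0 ?expR_ge1Dx//.
    by rewrite addr_ge0// mulr_ge0 ?exprn_ge0//; case/andP: d01.
  rewrite -expRM_natl ler_expR.
  have -> : D%:R * (r.+1%:R ^+ 2 * delta ^+ 2) = (r.+1 ^ 2 * D)%:R / (r ^ 12)%:R.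
    by rewrite /delta /x exprVn -exprM natrM !natrX mulrA [D%:R * _]mulrC.
  rewrite ler_pdivrMr ?ltr0n ?expn_gt0 ?r0// -natrM ler_nat.
  exact: flip_count_bound.
have m_ge : (r ^ 6 * r <= m)%N.
  by rewrite leq_divRL// -expnSr; apply: leq_trans rn;
  rewrite [X in (_ <= X)%N]expnSr leq_mul2l kr orbT.
(* By [pow_1sub_le] it suffices to bound [(1 + delta / 2) ^+ m] from below; by Bernoulli each block
   of [r ^ 6] factors contributes at least 3/2, hence at least [(1 + h) ^+ 9]. *)
have dm : (1 - delta / 2) ^+ m <= ((1 + h) ^+ (9 * r))^-1.
  have d2 : 0 <= delta / 2 <= 1 by case/andP: d01 => *; apply/andP; split; lra.
  have := pow_1sub_le m d2.
  have lower : (1 + h) ^+ (9 * r) <= (1 + delta / 2) ^+ m.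
    apply: le_trans (_ : (1 + delta / 2) ^+ (r ^ 6 * r) <= _); last first.
      by rewrite ler_weXn2l// lerDl; case/andP: d2.
    rewrite 2!exprM; apply: lerXn2r; rewrite ?nnegrE.
    - by apply: exprn_ge0; lra.
    - by apply: exprn_ge0; case/andP: d2; lra.
    - apply: le_trans (bernoulli (r ^ 6) _); last by case/andP: d2.
      rewrite natrX -/x mulrA mulfV ?mul1r ?gt_eqF ?(lt_le_trans ltr01 x6)//.
      by apply: le_trans H9 _; clear -h1; lra.
  have pos : 0 < (1 + h) ^+ (9 * r) by apply: exprn_gt0; lra.
  move=> prod1; rewrite -[leRHS]mul1r ler_pdivlMr//.
  apply: le_trans prod1; rewrite ler_wpM2l//.
  by apply: exprn_ge0; rewrite subr_ge0; case/andP: d2.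
have pos : 0 < (1 + h) ^+ (9 * r) by apply: exprn_gt0; lra.
move=> main.
have main2 : p - p' <= 49 * h * p' + (expR 2048 + 1) / (1 + h) ^+ (9 * r).
  apply: tail_arith main H9 (prob_ge0 _ _) _ dm.
  by apply: ler_wpM2r yD; rewrite invr_ge0 ltW.
apply: le_trans (ler_wpM2l (ler0n R m) main2) _.
rewrite mulrDr [m%:R * (49 * h * p')]mulrCA lerD2l.
have grow : (x * h) ^+ 9 <= (1 + h) ^+ (9 * r).
  rewrite mulnC exprM; apply: lerXn2r; rewrite ?nnegrE.
  - by rewrite mulr_ge0// ltW.
  - by apply: exprn_ge0; lra.
  - by apply: le_trans (bernoulli r (ltW h0)); rewrite lerDr.
have m_le : m%:R <= 256 * x ^+ 8.
  have m_le : (m <= 256 * r ^ 8)%N.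
    exact: leq_trans (leq_div _ _) (leq_trans (ltnW nr) (succ_pow8_le r0)).
  by move: m_le; rewrite -(ler_nat R) natrM natrX.
have c0 : 0 <= expR 2048 + 1 :> R by rewrite addr_ge0 ?expR_ge0.
exact: tail_error.
Qed.

(** * Limits *)

Section Asymptotics.
Variables (R : realType) (a b : R) (k : nat -> nat) (beta : R) (q : nat -> R).
Hypotheses (a0 : 0 < a) (ab : a < b) (k_gt0 : forall n, (0 < k n)%N).
Hypothesis k_small :
  (fun n : nat => (k n)%:R / (n%:R `^ (22%:R)^-1)) @ \oo --> (0 : R).
Hypothesis beta01 : 0 < beta < 1.
Hypothesis q_quantile : forall n : nat, is_quantile (tauN a b k (n:=n)) beta (q n).

(** The ratio is eventually below 1, so [k ^ 22 <= n]; hence [k ^ 8 <= n < r.+1 ^ 8] for the integer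
    part [r] of the eighth root. *)
Lemma near_root8 r0 : \forall n \near \oo, exists r,
  [/\ (r0 <= r)%N, (k n <= r)%N & (r ^ 8 <= n < r.+1 ^ 8)%N].
Proof.
move/cvgrPdist_lt: (k_small) => /(_ 1 ltr01) k1; near=> n.
have n0 : (r0.+1 ^ 8 <= n)%N by near: n; exact: nbhs_infty_ge.
have n_gt0 : (0 < n)%N by rewrite (leq_trans _ n0)// expn_gt0.
have k22 : (k n ^ 22 <= n)%N.
  have : `|0 - (k n)%:R / (n%:R `^ (22%:R)^-1)| < 1 :> R by near: n.
  have pos : 0 < n%:R `^ (22%:R)^-1 :> R by apply: powR_gt0; rewrite ltr0n.
  rewrite sub0r normrN ger0_norm; last by apply: divr_ge0 => //; exact: ltW.
  rewrite ltr_pdivrMr// mul1r => lt.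
  rewrite -(ler_nat R) natrX.
  apply: le_trans (_ : (n%:R `^ (22%:R)^-1) ^+ 22 <= _).
    by apply: lerXn2r; rewrite ?nnegrE ?powR_ge0//; exact: ltW.
  by rewrite -powR_mulrn ?powR_ge0// -powRrM mulVf// powRr1.
have [r /andP[rn nr]] := nat_root8 n.
exists r; split; last by rewrite rn.
- by apply: ltnW; rewrite -ltnS -(ltn_exp2r _ _ (isT : (0 < 8)%N)) (leq_ltn_trans n0 nr).
- rewrite -ltnS -(ltn_exp2r _ _ (isT : (0 < 8)%N)); apply: leq_ltn_trans nr.
  by apply: leq_trans k22; rewrite leq_pexp2l.
Unshelve. all: by end_near. Qed.

Let m n := (n %/ k n)%N.
Let p n : R := prob (fun w : cfg n => t_cross (env a b w) n (k n) 0 <= q n).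
Let p' n : R := prob (fun w : cfg n => t_cross (env a b w) n (k n) 0 < q n).

Lemma p01 n : 0 <= p n <= 1.
Proof. by rewrite prob_ge0 prob_le1. Qed.

Lemma p'01 n : 0 <= p' n <= 1.
Proof. by rewrite prob_ge0 prob_le1. Qed.

Lemma p'_le n : p' n <= p n.
Proof.
apply: EE_le => [|w]; first exact: unif_ge0.
by rewrite ler_nat; case: ltP => // /ltW ->.
Qed.

Lemma Pr_tau_gt n : (k n <= n)%N ->
  Pr (fun w : cfg n => tauN a b k w > q n) = (1 - p n) ^+ m n.
Proof.
move=> kn; rewrite Pr_prob /prob -(prob_prod a b (k_gt0 n) kn (fun x => x <= q n)).
by apply: EE_eq => w; rewrite -tau_gtE.
Qed.

Lemma Pr_tau_lt n : (k n <= n)%N ->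
  Pr (fun w : cfg n => tauN a b k w < q n) = 1 - (1 - p' n) ^+ m n.
Proof.
move=> kn; rewrite Pr_prob.
rewrite (@prob_compl R _ _ (fun w : cfg n => q n <= tauN a b k w)) => [|w]; last by rewrite -ltNge.
rewrite /prob -(prob_prod a b (k_gt0 n) kn (fun x => x < q n)); congr (_ - _).
by apply: EE_eq => w; rewrite -tau_geE.
Qed.

Lemma quantile_pow n : (k n <= n)%N ->
  (1 - p n) ^+ m n <= 1 - beta <= (1 - p' n) ^+ m n.
Proof.
move=> kn; have /andP[lt le] := q_quantile n.
move: lt; rewrite Pr_tau_lt// => lt.
have leE : Pr (fun w : cfg n => tauN a b k w <= q n) = 1 - (1 - p n) ^+ m n.
  rewrite -Pr_tau_gt// !Pr_prob; apply: prob_compl => w; by rewrite -leNgt.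
by move: le; rewrite leE => le; apply/andP; split; lra.
Qed.

Let B := beta / (1 - beta).

Lemma B_ge0 : 0 <= B.
Proof. by case/andP: beta01 => b0 b1; rewrite divr_ge0 ?subr_ge0 ?ltW. Qed.

(** From [1 - beta <= (1 - p') ^+ m] and [(1 - p') ^+ m * (1 + m p') <= 1], it follows that
    [m p' <= 1 / (1 - beta) - 1 = B]. *)
Lemma mp'_le n : (k n <= n)%N -> (m n)%:R * p' n <= B.
Proof.
move=> kn; case/andP: beta01 => b0 b1; have /andP[_ ge] := quantile_pow kn.
have le1 := pow_1sub_le (m n) (p'01 n).
have bern : 1 + (m n)%:R * p' n <= (1 + p' n) ^+ m n.
  by apply: bernoulli; case/andP: (p'01 n).
have mp0 : 0 <= (m n)%:R * p' n by rewrite mulr_ge0//; case/andP: (p'01 n).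
rewrite ler_pdivlMr ?subr_gt0//.
suff : (1 + (m n)%:R * p' n) * (1 - beta) <= 1 by lra.
apply: le_trans le1; rewrite mulrC; apply: ler_pM => //; lra.
Qed.

Lemma m_gap (e : R) : 0 < e -> \forall n \near \oo, (m n)%:R * (p n - p' n) <= e.
Proof.
move=> e0.
have B0 := B_ge0.
(* Chosen so that the main term [49 * h * (m p')] of [tail_comparison] is at most [e / 2], given
   [m p' <= B]. *)
pose h := Num.min 100^-1 (e / (98 * (B + 1))).
have h0 : 0 < h by rewrite lt_min invr_gt0 ltr0n divr_gt0// mulr_gt0//; lra.
have h1 : h <= 100^-1 by rewrite ge_min lexx.
have hB : 49 * h * B <= e / 2.
  have : h <= e / (98 * (B + 1)) by rewrite ge_min lexx orbT.
  rewrite ler_pdivlMr; last by rewrite mulr_gt0//; lra.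
  nra.
pose c : R := 256 * (expR 2048 + 1) / h ^+ 9.
have c0 : 0 <= c by rewrite divr_ge0 ?mulr_ge0 ?addr_ge0 ?expR_ge0 ?exprn_ge0 ?ltW.
(* Makes the remaining error [c / r] at most [e / 2], and ensures [2 <= r]. *)
pose r0 := (Num.truncn (c / (e / 2))).+2.
near=> n.
have [r [r0r kr rn]] : exists r, [/\ (r0 <= r)%N, (k n <= r)%N & (r ^ 8 <= n < r.+1 ^ 8)%N].
  by near: n; exact: near_root8.
have r2 : (2 <= r)%N by apply: leq_trans r0r.
have rgt0 : (0 < r)%N by apply: leq_trans r2.
have kn : (k n <= n)%N.
  case/andP: rn => rn _; apply: leq_trans (leq_trans kr _) rn.
  by rewrite -[X in (X <= _)%N]expn1 leq_pexp2l.
have := @tail_comparison _ a b (q n) h n (k n) r a0 ab.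
rewrite k_gt0 kr r2 rn h0 h1 => /(_ isT isT isT isT).
rewrite -/(p n) -/(p' n) -/(m n) -/c => tail.
apply: le_trans tail _.
have cr : c / r%:R <= e / 2.
  rewrite ler_pdivrMr ?ltr0n// mulrC -ler_pdivrMr; last by rewrite divr_gt0.
  apply: ltW; apply: lt_le_trans (truncnS_gt _) _.
  by rewrite ler_nat; apply: leq_trans r0r; exact: leqnSn.
have := mp'_le kn.
have : 0 <= 49 * h by rewrite mulr_ge0// ltW.
move=> h49 /(ler_wpM2l h49); lra.
Unshelve. all: by end_near. Qed.

Lemma near_k_le : \forall n \near \oo, (k n <= n)%N.
Proof.
near=> n.
have [r [r0r kr /andP[rn _]]] : exists r, [/\ (1 <= r)%N, (k n <= r)%N & (r ^ 8 <= n < r.+1 ^ 8)%N].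
  by near: n; exact: near_root8.
by apply: leq_trans (leq_trans kr _) rn; rewrite -[X in (X <= _)%N]expn1 leq_pexp2l.
Unshelve. all: by end_near. Qed.

Lemma near_m_ge (c : R) : \forall n \near \oo, c <= (m n)%:R.
Proof.
near=> n.
have [r [r0r kr /andP[rn _]]] : exists r,
    [/\ ((Num.truncn c).+1 <= r)%N, (k n <= r)%N & (r ^ 8 <= n < r.+1 ^ 8)%N].
  by near: n; exact: near_root8.
have rm : (r <= m n)%N.
  rewrite /m leq_divRL ?k_gt0//; apply: leq_trans rn.
  apply: leq_trans (leq_mul (leqnn r) kr) _.
  by rewrite mulnn leq_pexp2l//; apply: leq_trans r0r.
apply: ltW; apply: lt_le_trans (truncnS_gt _) _.
by rewrite ler_nat; exact: leq_trans r0r rm.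
Unshelve. all: by end_near. Qed.

Lemma pow_gap n : (1 - p' n) ^+ m n - (1 - p n) ^+ m n <= (m n)%:R * (p n - p' n).
Proof.
have /andP[p0 p1] := p01 n; have /andP[p'0 p'1] := p'01 n.
apply: le_trans (ler_norm _) _.
apply: le_trans (subr_pow_le (m n) _ _) _; try by apply/andP; split; lra.
by rewrite opprD addrA [X in X - _ + _]addrC addrK opprK addrC ger0_norm// subr_ge0 p'_le.
Qed.

(** By [quantile_pow], [1 - beta] lies between the two powers, whose difference tends to 0 by
    [pow_gap] and [m_gap]. *)
Lemma quantile_limits :
  (fun n : nat => Pr (fun w : cfg n => tauN a b k w < q n)) @ \oo --> beta /\
  (fun n : nat => Pr (fun w : cfg n => tauN a b k w > q n)) @ \oo --> 1 - beta.
Proof.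
split; apply/cvgrPdist_le => e e0; near=> n.
all: have kn : (k n <= n)%N by near: n; exact: near_k_le.
all: have gap : (m n)%:R * (p n - p' n) <= e by near: n; exact: m_gap.
all: have := pow_gap n; have /andP[lo hi] := quantile_pow kn.
all: rewrite ?Pr_tau_lt ?Pr_tau_gt// => pgap.
all: by rewrite ler_norml; apply/andP; split; lra.
Unshelve. all: by end_near. Qed.

Lemma noise_sensitive_tau :
  noise_sensitive (fun (n : nat) (w : cfg n) => (((q n < tauN a b k w)%R)%:R : R)).
Proof.
move=> eps eps01; have [c c0 corr_c] := corr_prob_bound eps01.
have eps01' : 0 <= eps <= 1 by case/andP: eps01 => *; apply/andP; split; lra.
apply/cvgrPdist_le => e e0.
have B0 := B_ge0; pose C := B + 1.
have C0 : 0 < C by rewrite /C; lra.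
have e2 : 0 < e / 2 by lra.
near=> n.
have kn : (k n <= n)%N by near: n; exact: near_k_le.
have mp : (m n)%:R * p n <= C.
  have : (m n)%:R * (p n - p' n) <= 1 by near: n; exact: m_gap.
  by have := mp'_le kn; rewrite /C; lra.
(* The two thresholds yield [m p ^+ 2 <= C ^+ 2 / m <= e / 2] and [(m rho) ^+ c <= C ^+ c.+1 / m <=
   (e / 2) ^+ c]. *)
have m1 : C ^+ 2 / (e / 2) <= (m n)%:R by near: n; exact: near_m_ge.
have m2 : C ^+ c.+1 / (e / 2) ^+ c <= (m n)%:R by near: n; exact: near_m_ge.
have m0 : 0 < (m n)%:R :> R.
  by apply: lt_le_trans m1; rewrite divr_gt0 ?exprn_gt0.
have /andP[p0 p1] := p01 n.
set A := fun w : cfg n => t_cross (env a b w) n (k n) 0 <= q n.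
pose rho := corr eps (fun w => (A w)%:R) (fun w => (A w)%:R) : R.
have rho_c : rho ^+ c <= p n ^+ c.+1 := corr_c _ A.
have rho0 : 0 <= rho by exact: corr_ge0.
have ExpE : Exp (fun w : cfg n => (q n < tauN a b k w)%R%:R : R) = (1 - p n) ^+ m n.
  by rewrite -Pr_tau_gt.
have corrE' : noise_corr eps (fun w : cfg n => (q n < tauN a b k w)%R%:R : R) =
    (1 - 2 * p n + rho) ^+ m n.
  rewrite noise_corrE.
  rewrite -[RHS](corr_prod a b (k_gt0 n) kn eps (fun x => x <= q n)).
  by apply: EE_eq => z; rewrite /tauN !tau_gtE.
(* Both terms become powers of exponent [m], so that [subr_pow_le] bounds their difference by [m]
   times that of the bases. *)
rewrite sub0r normrN ExpE corrE' -exprM mulnC exprM.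
apply: le_trans (subr_pow_le _ (corrN_itv A eps01') _) _.
by rewrite exprn_ge0 ?exprn_ile1//; lra.
have -> : 1 - 2 * p n + rho - (1 - p n) ^+ 2 = rho - p n ^+ 2 by ring.
apply: le_trans (ler_wpM2l (ltW m0) (ler_normB _ _)) _.
rewrite !ger0_norm ?sqr_ge0// mulrDr.
have t1 : (m n)%:R * rho <= e / 2.
  rewrite -(ler_pXn2r c0) ?nnegrE; [|by rewrite mulr_ge0|exact: ltW].
  have mc0 : 0 <= (m n)%:R ^+ c :> R by rewrite exprn_ge0.
  rewrite [leLHS]exprMn; apply: le_trans (ler_wpM2l mc0 rho_c) _.
  rewrite -(ler_pM2l m0).
  have -> : (m n)%:R * ((m n)%:R ^+ c * p n ^+ c.+1) = ((m n)%:R * p n) ^+ c.+1.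
    by rewrite exprMn [(m n)%:R ^+ c.+1]exprS mulrA.
  apply: le_trans (_ : C ^+ c.+1 <= _).
    by apply: lerXn2r; rewrite ?nnegrE; [rewrite mulr_ge0|exact: ltW|].
  by move: m2; rewrite ler_pdivrMr ?exprn_gt0.
have t2 : (m n)%:R * p n ^+ 2 <= e / 2.
  rewrite -(ler_pM2l m0) mulrA -expr2 -exprMn.
  apply: le_trans (_ : C ^+ 2 <= _).
    by apply: lerXn2r; rewrite ?nnegrE; [rewrite mulr_ge0|exact: ltW|].
  by move: m1; rewrite ler_pdivrMr.
lra.
Unshelve. all: by end_near. Qed.

End Asymptotics.

Theorem theorem5p1 (R : realType) (a b : R) (k : nat -> nat) (beta : R)
    (q : nat -> R) :
  0 < a -> a < b ->
  (forall n, (0 < k n)%N) ->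
  (fun n : nat => (k n)%:R / (n%:R `^ (22%:R)^-1)) @ \oo --> (0 : R) ->
  0 < beta < 1 ->
  (forall n : nat, is_quantile (tauN a b k (n:=n)) beta (q n)) ->
  [/\ (fun n : nat => Pr (fun w : cfg n => tauN a b k w < q n)) @ \oo --> beta,
      (fun n : nat => Pr (fun w : cfg n => tauN a b k w > q n)) @ \oo --> 1 - beta &
      noise_sensitive (fun (n : nat) (w : cfg n) => (((q n < tauN a b k w)%R)%:R : R))].
Proof.
move=> a0 ab k_gt0 k_small beta01 q_quantile.
have [lim_lt lim_gt] := quantile_limits a0 ab k_gt0 k_small beta01 q_quantile.
by split => //; exact: (noise_sensitive_tau a0 ab k_gt0 k_small beta01 q_quantile).
Qed.
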